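(* Let $A\in\mathbb{R}^{n\times n}$ and $b\in\mathbb{R}^n$ be such that $(A,b)$ satisfies the Kalman rank condition. For $T>0$ let $$p_T(y)=\frac{1}{(2\pi)^{n/2}\det(G_T(A,b))^{1/2}}\exp\Big(-\frac12\langle G_T(A,b)^{-1}y,y\rangle\Big),\qquad y\in\mathbb{R}^n,$$ be the transition density at time $T$ of the Ornstein–Uhlenbeck process $dX_t=AX_t\,dt+b\,dW_t$, $X_0=0$. Set $\ell_k=\kappa_kd_k(A,b)^2$ and, for $z=(z_1,\ldots,z_n)\in\mathbb{R}^n$ and $T>0$ sufficiently small, $$y_T(z)=\sum_{k=1}^n\ell_k^{1/2}\,T^{k-1/2}\,z_k\,\psi_k(T).$$ Then, as $T\to0^+$, uniformly for $z$ in compact subsets of $\mathbb{R}^n$, $$T^{n^2/2}\Big(\prod_{k=1}^n\ell_k\Big)^{1/2}p_T(y_T(z))=\frac{e^{-\|z\|^2/2}}{(2\pi)^{n/2}}\Big(1+\frac{T}{2}\sum_{k=1}^na_k(z_k^2-1)+\mathrm{O}(T^2)\Big).$$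
   Context: $\langle\cdot,\cdot\rangle$ is the Euclidean scalar product on $\mathbb{R}^n$ and $\|\cdot\|$ its norm; $W$ is a real Brownian motion. The Kalman rank condition is $\operatorname{rank}(b,Ab,\ldots,A^{n-1}b)=n$. For $T>0$, $G_T(A,b)=\int_0^Te^{tA}bb^\top e^{tA^\top}\,dt$ is the controllability Gramian, with eigenvalues ordered decreasingly $\lambda_1(T)\ge\cdots\ge\lambda_n(T)>0$. Krylov data: $\mathcal{K}_k(A,b)=\operatorname{span}(b,Ab,\ldots,A^{k-1}b)$, $\mathcal{K}_0(A,b)=\{0\}$. The orthonormal basis $(q_1,\ldots,q_n)$ is obtained by Gram–Schmidt from $b,Ab,\ldots,A^{n-1}b$, characterized by $q_k\in\mathcal{K}_k(A,b)$, $q_k\perp\mathcal{K}_{k-1}(A,b)$, $d_k(A,b):=\langle q_k,A^{k-1}b\rangle>0$. Set $a_k=\langle q_k,Aq_k\rangle$ and $\kappa_k=\frac{((k-1)!)^2}{(2k-1)!\,(2k-2)!}$ for $k\in\{1,\ldots,n\}$. For all sufficiently small $T>0$ the eigenvalues $\lambda_k(T)$ are simple and the eigenspace of $\lambda_k(T)$ is not orthogonal to $q_k$; $\psi_k(T)$ denotes the unit eigenvector of $G_T(A,b)$ associated with $\lambda_k(T)$ and oriented by $\langle\psi_k(T),q_k\rangle>0$. *)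

(* Defs.v *)
From HB Require Import structures.
From mathcomp Require Import all_boot all_order all_algebra.
From mathcomp Require Import all_classical all_reals all_analysis.

Set Implicit Arguments.
Unset Strict Implicit.
Unset Printing Implicit Defensive.

Import Order.TTheory GRing.Theory Num.Theory.
Import numFieldNormedType.Exports.

Local Open Scope classical_set_scope.
Local Open Scope ring_scope.

(* All indices are 0-based: the mathematical index k in {1, ..., n} is
   represented by k - 1 in {0, ..., n - 1}. Thus [krylov_basis A b k] is
   q_{k+1}, [krylov_coef A b k] is d_{k+1}, [psi A b T k] is psi_{k+1}(T), etc.
   Vectors of R^n are columns; the topology on 'cV[R]_n is the usual one, but
   the library norm `|v| is the sup norm, hence [enorm]. *)

Definition dotp (R : realType) (n : nat) (u v : 'cV[R]_n) : R :=
  \sum_(i < n) u i 0 * v i 0.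

Definition enorm (R : realType) (n : nat) (u : 'cV[R]_n) : R :=
  Num.sqrt (dotp u u).

Definition krylov (R : realType) (n : nat) (A : 'M[R]_n) (b : 'cV[R]_n)
  (k : nat) : 'cV[R]_n := A ^+ k *m b.

Definition kalman (R : realType) (n : nat) (A : 'M[R]_n) (b : 'cV[R]_n) : Prop :=
  \rank (\matrix_(i < n, j < n) krylov A b j i 0) = n.

Definition expmx (R : realType) (n : nat) (A : 'M[R]_n) : 'M[R]_n :=
  limn (series (fun k => (k`!%:R)^-1 *: A ^+ k)).

Definition gramian (R : realType) (n : nat) (A : 'M[R]_n) (b : 'cV[R]_n)
  (T : R) : 'M[R]_n :=
  \matrix_(i < n, j < n)
    \int[lebesgue_measure]_(t in `[0, T])
      (expmx (t *: A) *m b *m b^T *m expmx (t *: A^T)) i j.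

Fixpoint gram_schmidt (R : realType) (n : nat) (v : nat -> 'cV[R]_n) (m : nat)
  : seq 'cV[R]_n :=
  if m is m'.+1 then
    let s := gram_schmidt v m' in
    let w := v m' - \sum_(q <- s) dotp q (v m') *: q in
    rcons s ((enorm w)^-1 *: w)
  else [::].

Definition krylov_basis (R : realType) (n : nat) (A : 'M[R]_n) (b : 'cV[R]_n)
  (k : nat) : 'cV[R]_n := nth 0 (gram_schmidt (krylov A b) n) k.

Definition krylov_coef (R : realType) (n : nat) (A : 'M[R]_n) (b : 'cV[R]_n)
  (k : nat) : R := dotp (krylov_basis A b k) (krylov A b k).

Definition ritz (R : realType) (n : nat) (A : 'M[R]_n) (b : 'cV[R]_n)
  (k : nat) : R := dotp (krylov_basis A b k) (A *m krylov_basis A b k).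

(* kappa_{k+1} = (k!)^2 / ((2k+1)! (2k)!) *)
Definition kappa (R : realType) (k : nat) : R :=
  (k`! ^ 2)%:R / ((2 * k).+1`! * (2 * k)`!)%:R.

Definition ell (R : realType) (n : nat) (A : 'M[R]_n) (b : 'cV[R]_n)
  (k : nat) : R := kappa R k * krylov_coef A b k ^+ 2.

(* The eigenvalues of M in decreasing order, repeated according to algebraic
   multiplicity; [::] when the characteristic polynomial does not split over R,
   which never occurs for a symmetric M. *)
Definition eigenvalues (R : realType) (n : nat) (M : 'M[R]_n) : seq R :=
  xget [::] [set s : seq R |
    sorted >=%R s /\ char_poly M = \prod_(x <- s) ('X - x%:P)].

Definition lambda (R : realType) (n : nat) (A : 'M[R]_n) (b : 'cV[R]_n)
  (T : R) (k : nat) : R := nth 0 (eigenvalues (gramian A b T)) k.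

(* The conditions determine the vector uniquely, and are satisfiable, whenever
   the eigenvalue is simple and its eigenspace is not orthogonal to q_{k+1};
   the default value 0 is only taken when they are not satisfiable. *)
Definition psi (R : realType) (n : nat) (A : 'M[R]_n) (b : 'cV[R]_n)
  (T : R) (k : nat) : 'cV[R]_n :=
  xget 0 [set v : 'cV[R]_n |
    [/\ gramian A b T *m v = lambda A b T k *: v,
        enorm v = 1
      & 0 < dotp v (krylov_basis A b k)]].

(* Transition density at time T, from X_0 = 0, of dX_t = A X_t dt + b dW_t:
   the centred Gaussian density with covariance [gramian A b T]. *)
Definition ou_density (R : realType) (n : nat) (A : 'M[R]_n) (b : 'cV[R]_n)
  (T : R) (y : 'cV[R]_n) : R :=
  ((2 * pi) `^ (n%:R / 2) * Num.sqrt (\det (gramian A b T)))^-1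
  * expR (- (1 / 2) * dotp (invmx (gramian A b T) *m y) y).

(* The exponent is (k + 1) - 1/2. *)
Definition scaled_point (R : realType) (n : nat) (A : 'M[R]_n) (b : 'cV[R]_n)
  (T : R) (z : 'cV[R]_n) : 'cV[R]_n :=
  \sum_(k < n) (Num.sqrt (ell A b k) * T `^ (k.+1%:R - 1 / 2) * z k 0)
    *: psi A b T k.

(* Main.v *)
From HB Require Import structures.
Require Import Defs.
From mathcomp Require Import all_boot all_order all_algebra fingroup perm.
From mathcomp Require Import all_classical all_reals all_analysis.
From mathcomp Require Import measurable_realfun.
From mathcomp Require Import ring lra zify.
Set Implicit Arguments.
Unset Strict Implicit.
Unset Printing Implicit Defensive.
Import Order.TTheory GRing.Theory Num.Theory.
Import numFieldNormedType.Exports.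
Local Open Scope classical_set_scope.
Local Open Scope ring_scope.

(** In the Krylov basis q_0, ..., q_(n-1) the matrix A is upper Hessenberg, so
    that <q_i, e^(tA) b> = lead i * t^i * (1 + drift i * t + O(t^2)). Hence the
    (i, j) entry of G_T in this basis is
      T^(i+j+1) * lead i * lead j
        * (1/(i+j+1) + T * (drift i + drift j)/(i+j+2) + O(T^2))
    ([gramian_krylov]): up to the powers of T, a perturbation of the Hilbert
    matrix. The latter is the Gram matrix of the monomials on [0, 1], so it is
    diagonalised by the shifted Legendre polynomials, with diagonal entries
    h_i = [legendre_sqnorm i]; the first-order term then has diagonal entries
    h_i * a_i, because (i+1) * drift i - i * drift (i-1) = a_i is the i-th Ritz
    value ([legendre_variation], [driftE], [graded_form_expansion]).

    For the k-th eigenvalue, put lambda = T^(2k+1) * mu and write lambda - G_T in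
    the Legendre frame whose i-th vector is rescaled by T^(-min(i, k)). This gives
    T times a matrix [pencil T mu] whose off-diagonal entries are O(T), and whose
    i-th diagonal entry tends to - h_i for i < k, to mu / (lead i)^2 for i > k,
    and to mu / (lead k)^2 - h_k for i = k. A permutation other than the identity
    uses two off-diagonal entries, so the determinant is the product of the
    diagonal entries up to O(T^2) ([bigO_det]). It changes sign when mu crosses
    ell_k = (lead k)^2 * h_k, and at the root the k-th diagonal entry must itself
    be O(T^2): this is lambda_k = T^(2k+1) * ell_k * (1 + a_k * T + O(T^2))
    ([pencil_root]). The n roots found in this way have distinct orders of
    magnitude, so they are the whole spectrum. In the same frame, the rows other
    than the k-th are diagonally dominant, so an eigenvector is concentrated on
    the k-th coordinate and is not orthogonal to q_k
    ([eigenvector_not_orthogonal]); thus the psi_k form an orthonormal eigenbasis.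

    Consequently <G_T^(-1) y_T(z), y_T(z)> = sum_k rho_k * z_k^2 and
    T^(n^2) * prod_k ell_k / det G_T = prod_k rho_k, where
    rho_k = ell_k * T^(2k+1) / lambda_k = 1 - a_k * T + O(T^2)
    ([ratio_expansion]), and it remains to expand a square root and an
    exponential to second order. *)

(** * Euclidean product *)

Section EuclideanProduct.
Variables (R : realType) (n : nat).
Implicit Types (u v w : 'cV[R]_n) (c : R).

Lemma dotpC u v : dotp u v = dotp v u.
Proof. by apply: eq_bigr => i _; rewrite mulrC. Qed.

Lemma dotpDr u v w : dotp u (v + w) = dotp u v + dotp u w.
Proof. by rewrite -big_split; apply: eq_bigr => i _; rewrite mxE mulrDr. Qed.

Lemma dotpZr c u v : dotp u (c *: v) = c * dotp u v.
Proof. by rewrite mulr_sumr; apply: eq_bigr => i _; rewrite mxE mulrCA. Qed.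

Lemma dotpZl c u v : dotp (c *: u) v = c * dotp u v.
Proof. by rewrite dotpC dotpZr dotpC. Qed.

Lemma dotp0 u : dotp u 0 = 0.
Proof. by rewrite -(scale0r 0) dotpZr mul0r. Qed.

Lemma dotpBr u v w : dotp u (v - w) = dotp u v - dotp u w.
Proof. by rewrite dotpDr -scaleN1r dotpZr mulN1r. Qed.

Lemma dotp_sumr (I : Type) (r : seq I) (P : pred I) (F : I -> 'cV[R]_n) u :
  dotp u (\sum_(i <- r | P i) F i) = \sum_(i <- r | P i) dotp u (F i).
Proof.
by apply: (big_morph (dotp u)) => [x y|]; [exact: dotpDr|exact: dotp0].
Qed.

Lemma dotp_suml (I : Type) (r : seq I) (P : pred I) (F : I -> 'cV[R]_n) u :
  dotp (\sum_(i <- r | P i) F i) u = \sum_(i <- r | P i) dotp (F i) u.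
Proof. by rewrite dotpC dotp_sumr; apply: eq_bigr => i _; rewrite dotpC. Qed.

Lemma dotpE u v : dotp u v = (u^T *m v) 0 0.
Proof. by rewrite mxE; apply: eq_bigr => i _; rewrite mxE. Qed.

Lemma dotp_mull (M : 'M[R]_n) u v : dotp (M *m u) v = dotp u (M^T *m v).
Proof. by rewrite !dotpE trmx_mul -mulmxA. Qed.

Lemma dotp_ge0 u : 0 <= dotp u u.
Proof. by apply: sumr_ge0 => i _; rewrite -expr2 sqr_ge0. Qed.

Lemma dotp_eq0 u : (dotp u u == 0) = (u == 0).
Proof.
apply/idP/eqP => [|->]; last by rewrite dotp0.
rewrite psumr_eq0 => [/allP h|i _]; last by rewrite -expr2 sqr_ge0.
apply/colP => i; rewrite mxE; apply/eqP; rewrite -sqrf_eq0 expr2.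
exact: (h i (mem_index_enum i)).
Qed.

Lemma enorm_sqr u : enorm u ^+ 2 = dotp u u.
Proof. by rewrite /enorm sqr_sqrtr ?dotp_ge0. Qed.

Lemma enorm_eq0 u : (enorm u == 0) = (u == 0).
Proof. by rewrite -sqrf_eq0 enorm_sqr dotp_eq0. Qed.

Lemma enorm_gt0 u : (0 < enorm u) = (u != 0).
Proof. by rewrite lt_neqAle eq_sym enorm_eq0 sqrtr_ge0 andbT. Qed.

Lemma enormZ c u : 0 <= c -> enorm (c *: u) = c * enorm u.
Proof.
move=> c0; rewrite /enorm dotpZl dotpZr mulrA -expr2 sqrtrM ?sqr_ge0 //.
by rewrite sqrtr_sqr ger0_norm.
Qed.

End EuclideanProduct.

(** * Gram-Schmidt orthonormalisation *)

Section GramSchmidt.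
Variables (R : realType) (n : nat) (v : nat -> 'cV[R]_n).

Definition gs_vec k : 'cV[R]_n := nth 0 (gram_schmidt v k.+1) k.

Definition gs_residual k : 'cV[R]_n :=
  v k - \sum_(j < k) dotp (gs_vec j) (v k) *: gs_vec j.

Lemma size_gram_schmidt m : size (gram_schmidt v m) = m.
Proof. by elim: m => //= m IH; rewrite size_rcons IH. Qed.

Lemma gram_schmidtE m : gram_schmidt v m = mkseq gs_vec m.
Proof.
apply: (@eq_from_nth _ 0); rewrite size_gram_schmidt ?size_mkseq // => k km.
rewrite nth_mkseq //; elim: m km => // m IH.
rewrite ltnS leq_eqVlt => /predU1P[-> //|km].
by rewrite /= nth_rcons size_gram_schmidt km IH.
Qed.

Lemma gs_vecE k : gs_vec k = (enorm (gs_residual k))^-1 *: gs_residual k.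
Proof.
rewrite {1}/gs_vec /= nth_rcons size_gram_schmidt ltnn eqxx gram_schmidtE.
by rewrite big_map -[in iota 0 k](subn0 k) -/(index_iota 0 k) big_mkord.
Qed.

Lemma gs_decomp k : v k = enorm (gs_residual k) *: gs_vec k
  + \sum_(j < k) dotp (gs_vec j) (v k) *: gs_vec j.
Proof.
have -> : enorm (gs_residual k) *: gs_vec k = gs_residual k.
  rewrite gs_vecE scalerA; have [e0|e0] := eqVneq (enorm (gs_residual k)) 0.
    by move/eqP: e0; rewrite enorm_eq0 => /eqP ->; rewrite scaler0.
  by rewrite divff // scale1r.
by rewrite /gs_residual subrK.
Qed.

Definition gs_coef l k : R := if (l < k)%N then dotp (gs_vec l) (v k)
  else if l == k then enorm (gs_residual k) else 0.

(** The factorisation V = Q R, with R upper triangular: since the diagonal of R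
    carries the norms of the Gram-Schmidt residuals, taking determinants shows
    that none of them vanishes when the family is independent. *)
Lemma gs_residual_neq0 :
  \det (\matrix_(i < n, j < n) v j i 0) != 0 ->
  forall k, (k < n)%N -> gs_residual k != 0.
Proof.
move=> dV k kn.
have VE : \matrix_(i < n, j < n) v j i 0 =
   (\matrix_(i < n, j < n) gs_vec j i 0) *m
   (\matrix_(i < n, j < n) gs_coef i j).
  apply/matrixP => i j; rewrite !mxE gs_decomp !mxE summxE.
  rewrite (bigD1 j) //= !mxE /gs_coef ltnn eqxx mulrC; congr (_ + _).
  rewrite (big_ord_widen n (fun l => (dotp (gs_vec l) (v j) *: gs_vec l) i 0));
    last exact: ltnW.
  rewrite big_mkcond [RHS]big_mkcond /=; apply: eq_bigr => l _.
  rewrite !mxE; case: ltngtP => [lj|lj|/val_inj ->]; rewrite ?eqxx //.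
    by rewrite ifT 1?mulrC // -val_eqE /= ltn_eqF.
  by rewrite mulr0 if_same.
move: dV; rewrite VE det_mulmx mulf_eq0 negb_or => /andP[_].
rewrite -det_tr det_trig; last first.
  by apply/is_trig_mxP => i j ij; rewrite !mxE /gs_coef ltnNge ltnW //= gtn_eqF.
move/prodf_neq0 => /(_ (Ordinal kn) isT).
by rewrite !mxE /gs_coef ltnn eqxx enorm_eq0.
Qed.

Lemma gs_orthonormal : (forall k, (k < n)%N -> gs_residual k != 0) ->
  forall k l, (k < n)%N -> (l < n)%N ->
  dotp (gs_vec k) (gs_vec l) = (k == l)%:R.
Proof.
move=> r0.
have unit k : (k < n)%N -> dotp (gs_vec k) (gs_vec k) = 1.
  move=> kn; rewrite gs_vecE dotpZl dotpZr -enorm_sqr.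
  by rewrite expr2 mulKf ?mulVf // enorm_eq0 r0.
suff lt m k l : (l < m)%N -> (k < l)%N -> (l < n)%N ->
    dotp (gs_vec k) (gs_vec l) = 0.
  move=> k l kn ln; case: ltngtP => [kl|lk|->]; last exact: unit.
    exact: (lt l.+1).
  by rewrite dotpC; apply: (lt k.+1).
elim: m k l => // m IH k l lm kl ln.
rewrite [gs_vec l]gs_vecE dotpZr dotpBr dotp_sumr (bigD1 (Ordinal kl)) //=.
rewrite dotpZr unit ?(ltn_trans kl) // mulr1 big1 ?addr0 ?subrr ?mulr0 //.
move=> j; rewrite -val_eqE /= => jk; rewrite dotpZr.
have jn : (j < n)%N by apply: ltn_trans ln.
move: jk; case: ltngtP => // jk _.
  by rewrite (dotpC (gs_vec k)) (IH j k) ?mulr0 ?(leq_trans kl lm) ?(ltn_trans kl ln).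
by rewrite (IH k j) ?mulr0 // (leq_trans (ltn_ord j) lm).
Qed.

End GramSchmidt.

(** * The Krylov basis *)

Section KrylovBasis.
Variables (R : realType) (n : nat) (A : 'M[R]_n) (b : 'cV[R]_n).
Hypothesis hAb : kalman A b.

Let q := krylov_basis A b.
Let v := krylov A b.
Let d := krylov_coef A b.
Let r k := enorm (gs_residual v k).

Lemma krylovS k : v k.+1 = A *m v k.
Proof. by rewrite /v /krylov exprS -mulmxA. Qed.

Lemma krylov_basisE k : (k < n)%N -> q k = gs_vec v k.
Proof. by move=> kn; rewrite /q /krylov_basis gram_schmidtE nth_mkseq. Qed.

Lemma krylov_residual_neq0 k : (k < n)%N -> gs_residual v k != 0.
Proof.
move: k; apply: gs_residual_neq0; rewrite -unitfE -[_ \is a _]unitmxE.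
by rewrite -row_full_unit /row_full; apply/eqP; exact: hAb.
Qed.

Lemma krylov_basis_orthonormal k l : (k < n)%N -> (l < n)%N ->
  dotp (q k) (q l) = (k == l)%:R.
Proof.
move=> kn ln; rewrite !krylov_basisE //.
by apply: gs_orthonormal => // j; exact: krylov_residual_neq0.
Qed.

Lemma krylov_decomp k : (k < n)%N ->
  v k = r k *: q k + \sum_(j < k) dotp (q j) (v k) *: q j.
Proof.
move=> kn; rewrite [LHS](gs_decomp v) -krylov_basisE //.
congr (_ + _); apply: eq_bigr => j _.
by rewrite -krylov_basisE // (ltn_trans _ kn).
Qed.

Lemma krylov_orthogonal i k : (k < i)%N -> (i < n)%N -> dotp (q i) (v k) = 0.
Proof.
move=> ki iN; have kn := ltn_trans ki iN.
rewrite krylov_decomp // dotpDr dotpZr dotp_sumr krylov_basis_orthonormal //.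
rewrite gtn_eqF // mulr0 add0r big1 // => j _; have jk := ltn_ord j.
rewrite dotpZr krylov_basis_orthonormal //; last exact: ltn_trans kn.
by rewrite gtn_eqF ?mulr0 // (ltn_trans jk).
Qed.

Lemma krylov_coefE k : (k < n)%N -> d k = r k.
Proof.
move=> kn; rewrite /d /krylov_coef -/q -/v krylov_decomp // dotpDr dotpZr.
rewrite dotp_sumr krylov_basis_orthonormal // eqxx mulr1 big1 ?addr0 // => j _.
have jk := ltn_ord j; rewrite dotpZr krylov_basis_orthonormal //.
  by rewrite gtn_eqF ?mulr0.
exact: ltn_trans kn.
Qed.

Lemma krylov_coef_gt0 k : (k < n)%N -> 0 < d k.
Proof.
by move=> kn; rewrite krylov_coefE // enorm_gt0 krylov_residual_neq0.
Qed.

(** The Hessenberg form of A: up to vectors A q_l with l < j, A q_j is a multiple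
    of A^(j+1) b, which is orthogonal to q_i. *)
Lemma krylov_hessenberg i j : (j.+1 < i)%N -> (i < n)%N ->
  dotp (q i) (A *m q j) = 0.
Proof.
elim/ltn_ind: j => j IH ji iN.
have jn : (j < n)%N by lia.
have r0 : r j != 0 by rewrite enorm_eq0 krylov_residual_neq0.
apply: (mulfI r0); rewrite mulr0 -dotpZr scalemxAr.
have -> : r j *: q j = v j - \sum_(l < j) dotp (q l) (v j) *: q l.
  by rewrite {1}krylov_decomp // addrK.
rewrite mulmxBr -krylovS dotpBr krylov_orthogonal // mulmx_sumr dotp_sumr big1.
  by rewrite subr0.
move=> l _; rewrite -scalemxAr dotpZr IH ?mulr0 //.
by have := ltn_ord l; lia.
Qed.

(** By the Hessenberg form, a component of A^k b along q_j, with j < k <= i,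
    reaches q_i after one more application of A only if j + 1 = i. *)
Lemma krylov_step i k : (k < n)%N -> (k <= i)%N -> (i < n)%N ->
  dotp (q i) (v k.+1) = dotp (q k) (v k) * dotp (q i) (A *m q k)
    + \sum_(j < k | j.+1 == i) dotp (q j) (v k) * dotp (q i) (A *m q j).
Proof.
move=> kn ki iN; rewrite krylovS {1}krylov_decomp // mulmxDr dotpDr.
rewrite -scalemxAr dotpZr -krylov_coefE // mulmx_sumr dotp_sumr; congr (_ + _).
rewrite [RHS]big_mkcond /=; apply: eq_bigr => j _.
rewrite -scalemxAr dotpZr; case: eqP => // ji.
by rewrite krylov_hessenberg ?mulr0 //; have := ltn_ord j; lia.
Qed.

(** The coefficient of A^(i+1) b on q_i: a path of length i + 1 from 0 to i in a
    Hessenberg matrix makes i unit steps and one stop, at some j <= i. *)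
Lemma krylov_next i : (i < n)%N ->
  dotp (q i) (v i.+1) = d i * \sum_(j < i.+1) ritz A b j.
Proof.
elim: i => [|i IH] iN; rewrite krylov_step //.
  by rewrite big_pred0 ?addr0 ?big_ord1 // => -[].
rewrite big_ord_recr /= mulrDr addrC; congr (_ + _); last first.
have iN' := ltnW iN.
rewrite (bigD1 (Ordinal (ltnSn i))) //= big1 ?addr0; last first.
  by move=> j; rewrite -val_eqE /= eqSS => /andP[/eqP ->]; rewrite eqxx.
have -> : d i.+1 = d i * dotp (q i.+1) (A *m q i).
  rewrite /d /krylov_coef -/v krylov_step // big_pred0 ?addr0 // => j.
  by apply/negP => /eqP; have := ltn_ord j; lia.
by rewrite IH // mulrAC.
Qed.

End KrylovBasis.

(** * Matrix exponential *)

(** Completeness lets absolute convergence give convergence of matrix series. *)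
HB.instance Definition _ (R : realType) (m n : nat) :=
  Complete.on 'M[R]_(m, n).

Section MatrixExponential.
Variables (R : realType) (n : nat).
Implicit Types (A : 'M[R]_n) (t : R).

Definition entry_sum A : R := \sum_i \sum_j `|A i j|.

Lemma entry_sum_ge0 A : 0 <= entry_sum A.
Proof. by apply: sumr_ge0 => i _; apply: sumr_ge0. Qed.

Lemma exprmx_entry_le A k i j : `|(A ^+ k) i j| <= entry_sum A ^+ k.
Proof.
elim: k i j => [|k IH] i j.
  by rewrite !expr0 mxE; case: (i == j); rewrite ?normr1 ?normr0.
rewrite exprS mxE (le_trans (ler_norm_sum _ _ _)) // exprS.
apply: (@le_trans _ _ (\sum_l `|A i l| * entry_sum A ^+ k)).
  by apply: ler_sum => l _; rewrite normrM ler_wpM2l.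
rewrite -mulr_suml ler_wpM2r ?exprn_ge0 ?entry_sum_ge0 //.
rewrite /entry_sum [leRHS](bigD1 i) //= lerDl.
by apply: sumr_ge0 => l _; apply: sumr_ge0.
Qed.

Lemma exprmxZ A t k : (t *: A) ^+ k = t ^+ k *: A ^+ k.
Proof.
elim: k => [|k IH]; first by rewrite !expr0 scale1r.
rewrite !exprS IH -[LHS]/((t *: A) *m (t ^+ k *: A ^+ k)).
by rewrite -scalemxAl -scalemxAr scalerA.
Qed.

Lemma is_cvg_expmx A : cvgn (series (fun k => (k`!%:R)^-1 *: A ^+ k)).
Proof.
apply: normed_cvg.
apply: (@series_le_cvg _ _ (exp_coeff (entry_sum A))) => [k|k|k|].
- exact: normr_ge0.
- by rewrite /exp_coeff /= divr_ge0 ?exprn_ge0 ?entry_sum_ge0.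
- rewrite /exp_coeff /= normrZ mulrC ger0_norm ?invr_ge0 //.
  rewrite ler_wpM2r ?invr_ge0 // [leLHS]/Num.Def.normr /= mx_normrE.
  apply: bigmax_le => [|[p q] _]; first by rewrite exprn_ge0 ?entry_sum_ge0.
  exact: exprmx_entry_le.
- exact: is_cvg_series_exp_coeff.
Qed.

Definition expmx_partial A m t : 'M[R]_n :=
  \sum_(0 <= k < m) (t ^+ k / k`!%:R) *: A ^+ k.

Lemma expmx_partial_cvg A t i j :
  expmx_partial A m t i j @[m --> \oo] --> expmx (t *: A) i j.
Proof.
have h := @is_cvg_expmx (t *: A).
rewrite (_ : (fun m => _) = (fun M : 'M[R]_n => M i j) \o
    series (fun k => (k`!%:R)^-1 *: (t *: A) ^+ k)).
  exact: cvg_comp _ _ h (@coord_continuous R n n i j (expmx (t *: A))).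
apply/funext => m; rewrite /series /= /expmx_partial !summxE; apply: eq_bigr => k _.
by rewrite exprmxZ !mxE mulrA [_^-1 * _]mulrC.
Qed.

Lemma expmx_tail A m t i j : 0 <= t <= 1 ->
  `|expmx (t *: A) i j - expmx_partial A m t i j|
  <= expR (entry_sum A) * t ^+ m.
Proof.
case/andP=> t0 t1; set c := entry_sum A.
have lim : `|expmx_partial A N t i j - expmx_partial A m t i j| @[N --> \oo]
    --> `|expmx (t *: A) i j - expmx_partial A m t i j|.
  by apply: cvg_norm; apply: cvgB (@expmx_partial_cvg A t i j) (cvg_cst _).
rewrite -(cvg_lim _ lim) //; apply: limr_le; first by apply/cvg_ex; eexists; exact: lim.
near=> N; have mN : (m <= N)%N by near: N; exists m.
have -> : expmx_partial A N t i j - expmx_partial A m t i j =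
    \sum_(m <= k < N) ((t ^+ k / k`!%:R) *: A ^+ k) i j.
  rewrite /expmx_partial !summxE (@big_cat_nat _ _ _ m 0 N) //=.
  by rewrite addrAC subrr add0r.
rewrite (le_trans (ler_norm_sum _ _ _)) //.
apply: (@le_trans _ _ (\sum_(m <= k < N) (c ^+ k / k`!%:R) * t ^+ m)).
  rewrite big_nat_cond [leRHS]big_nat_cond; apply: ler_sum => k /andP[/andP[mk _] _].
  rewrite mxE normrM ger0_norm ?divr_ge0 ?exprn_ge0 // mulrC mulrA mulrAC.
  rewrite ler_pM ?mulr_ge0 ?exprn_ge0 ?invr_ge0 // ?ler_wpM2r ?invr_ge0 //.
    exact: exprmx_entry_le.
  exact: ler_wiXn2l.
rewrite -mulr_suml ler_wpM2r ?exprn_ge0 //.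
apply: (@le_trans _ _ (series (exp_coeff c) N)).
  rewrite /series /= [leRHS](@big_cat_nat _ _ _ m 0 N) //= lerDr.
  by apply: sumr_ge0 => k _; rewrite divr_ge0 ?exprn_ge0 ?entry_sum_ge0.
apply: nondecreasing_cvgn_le; last exact: is_cvg_series_exp_coeff.
apply: nondecreasing_series => k _ _.
by rewrite divr_ge0 ?exprn_ge0 ?entry_sum_ge0.
Unshelve. all: by end_near. Qed.

Lemma trmx_exprn A k : (A ^+ k)^T = A^T ^+ k.
Proof.
by elim: k => [|k IH]; rewrite ?expr0 ?trmx1 // exprSr trmx_mul IH exprS.
Qed.

Lemma expmx_trmx A t : expmx (t *: A^T) = (expmx (t *: A))^T.
Proof.
apply/matrixP => i j; rewrite mxE.
apply: (@cvg_unique _ (@Rhausdorff R) (expmx_partial A^T m t i j @[m --> \oo])).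
  exact: expmx_partial_cvg.
rewrite (_ : (fun m => _) = (fun m => expmx_partial A m t j i)).
  exact: expmx_partial_cvg.
apply/funext => m; rewrite /expmx_partial !summxE; apply: eq_bigr => k _.
by rewrite -trmx_exprn !mxE.
Qed.

Lemma measurable_expmx A i j (D : set R) : measurable D ->
  measurable_fun D (fun t => expmx (t *: A) i j).
Proof.
move=> mD; apply: (@measurable_fun_cvg _ _ _ _ (fun m t => expmx_partial A m t i j)).
  move=> m; rewrite /expmx_partial.
  under eq_fun do rewrite summxE.
  apply: measurable_sum => k; under eq_fun do rewrite mxE.
  by apply: measurable_funM => //; apply: measurable_funM => //.
by move=> t _; exact: expmx_partial_cvg.
Qed.

Lemma dotp_expmx_tail A (b u : 'cV[R]_n) m : exists C : R, forall t, 0 <= t <= 1 ->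
  `|dotp u (expmx (t *: A) *m b)
    - \sum_(k < m) t ^+ k / k`!%:R * dotp u (A ^+ k *m b)| <= C * t ^+ m.
Proof.
exists (\sum_i \sum_j `|u i 0| * `|b j 0| * expR (entry_sum A)) => t t01.
have -> : \sum_(k < m) t ^+ k / k`!%:R * dotp u (A ^+ k *m b) =
    dotp u (expmx_partial A m t *m b).
  rewrite /expmx_partial mulmx_suml dotp_sumr big_mkord; apply: eq_bigr => k _.
  by rewrite -scalemxAl dotpZr.
rewrite -dotpBr -mulmxBl /dotp (le_trans (ler_norm_sum _ _ _)) // mulr_suml.
apply: ler_sum => i _; rewrite mxE mulr_sumr (le_trans (ler_norm_sum _ _ _)) //.
rewrite mulr_suml; apply: ler_sum => j _.
rewrite !normrM [`|_ i j| * _]mulrC mulrA -[leRHS]mulrA ler_wpM2l ?mulr_ge0 //.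
by rewrite !mxE; exact: expmx_tail.
Qed.

End MatrixExponential.

(** * Integration of two-term expansions *)

Section Integrals.
Variable R : realType.
Notation mu := (@lebesgue_measure R).

Lemma integral_exprn m (T : R) : 0 < T ->
  \int[mu]_(t in `[0, T]) t ^+ m = T ^+ m.+1 / m.+1%:R.
Proof.
move=> T0; rewrite /Rintegral.
rewrite (@continuous_FTC2 _ _ (fun x => x ^+ m.+1 / m.+1%:R)) //=.
- by rewrite expr0n mul0r subr0.
- by apply: continuous_in_subspaceT => x _; exact: exprn_continuous.
- have c (x : R) : {for x, continuous (fun y : R => y ^+ m.+1 / m.+1%:R)}.
    by apply: cvgMl; exact: exprn_continuous.
  split=> [x _||].
  + apply: (@derivableM _ _ (fun y : R => y ^+ m.+1) (fun=> m.+1%:R^-1)) => //.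
    exact: exprn_derivable.
  + exact/cvg_at_right_filter/c.
  + exact/cvg_at_left_filter/c.
- move=> x _; rewrite derive1Mr; last exact: exprn_derivable.
  by rewrite exp_derive1 mulrAC divff ?mul1r.
Qed.

Lemma integrable_le (f : R -> R) (T C : R) :
  measurable_fun `[0, T] f -> (forall t, 0 <= t <= T -> `|f t| <= C) ->
  mu.-integrable `[0, T] (EFin \o f).
Proof.
move=> mf fC; apply: measurable_bounded_integrable => //.
  by apply: compact_finite_measure; exact: segment_compact.
exists C; split; first exact: num_real.
by move=> M CM t /=; rewrite in_itv /= => /fC h; exact: le_trans h (ltW CM).
Qed.

Lemma integral_expansion (f : R -> R) m (c0 c1 C T : R) :
  0 < T -> T <= 1 -> measurable_fun `[0, T] f ->
  (forall t, 0 <= t <= 1 ->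
    `|f t - (c0 * t ^+ m + c1 * t ^+ m.+1)| <= C * t ^+ m.+2) ->
  `|\int[mu]_(t in `[0, T]) f t
    - (c0 * (T ^+ m.+1 / m.+1%:R) + c1 * (T ^+ m.+2 / m.+2%:R))|
  <= C * T ^+ m.+3.
Proof.
move=> T0 T1 mf fC.
have C0 : 0 <= C.
  have := fC 1; rewrite !expr1n !mulr1 => /(_ _)/(le_trans (normr_ge0 _)); apply.
  by rewrite ler01 lexx.
have mp k : measurable_fun `[0, T] (fun t : R => t ^+ k) by [].
have icp c k : mu.-integrable `[0, T] (EFin \o (fun t : R => c * t ^+ k)).
  apply: (@integrable_le _ _ `|c|) => [|t /andP[t0 tT]].
    exact: measurable_funM.
  by rewrite normrM normrX ler_piMr // exprn_ile1 // ger0_norm // (le_trans tT).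
have ip k : mu.-integrable `[0, T] (EFin \o (fun t : R => t ^+ k)).
  by have := icp 1 k; under [fun t => 1 * _]eq_fun do rewrite mul1r.
set p := fun t : R => c0 * t ^+ m + c1 * t ^+ m.+1.
have iD g h : mu.-integrable `[0, T] (EFin \o g) ->
    mu.-integrable `[0, T] (EFin \o h) ->
    mu.-integrable `[0, T] (EFin \o (fun t => g t + h t)).
  by move=> ig ih; have := integrableD _ ig ih; apply.
have ipp : mu.-integrable `[0, T] (EFin \o p) by apply: iD; exact: icp.
have ir : mu.-integrable `[0, T] (EFin \o (fun t => f t - p t)).
  apply: (@integrable_le _ _ C) => [|t /andP[t0 tT]].
    apply: measurable_funB => //; apply: measurable_funD; exact: measurable_funM.
  have t1 : t <= 1 by apply: le_trans tT T1.
  by rewrite (le_trans (fC t _)) ?t0 // ler_piMr // exprn_ile1.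
have if_ : mu.-integrable `[0, T] (EFin \o f).
  rewrite (_ : f = (fun t => (f t - p t) + p t)); first exact: iD.
  by apply/funext => t; rewrite subrK.
have -> : c0 * (T ^+ m.+1 / m.+1%:R) + c1 * (T ^+ m.+2 / m.+2%:R) =
    \int[mu]_(t in `[0, T]) p t.
  by rewrite RintegralD // !RintegralZl // !integral_exprn.
rewrite -RintegralB // (le_trans (le_normr_Rintegral _ _)) //.
apply: (@le_trans _ _ (\int[mu]_(t in `[0, T]) (C * t ^+ m.+2))).
  apply: le_Rintegral => // [|t].
    exact: integrable_norm ir.
  rewrite /= in_itv /= => /andP[t0 tT]; apply: fC.
  by rewrite t0 (le_trans tT).
rewrite RintegralZl // integral_exprn // ler_wpM2l // ler_pdivrMr //.
by rewrite ler_peMr ?exprn_ge0 ?(ltW T0) // ler1n.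
Qed.

End Integrals.

(** * The Gramian in the Krylov basis *)

Section Gramian.
Variables (R : realType) (n : nat) (A : 'M[R]_n) (b : 'cV[R]_n).
Notation mu := (@lebesgue_measure R).

Definition response (u : 'cV[R]_n) (t : R) : R := dotp u (expmx (t *: A) *m b).

Lemma measurable_response u (D : set R) : measurable D ->
  measurable_fun D (response u).
Proof.
move=> mD; rewrite /response /dotp; apply: measurable_sum => i.
apply: measurable_funM => //; under eq_fun do rewrite mxE.
apply: measurable_sum => j; apply: measurable_funM => //.
exact: measurable_expmx.
Qed.

Lemma response_bounded u : exists C : R, forall t, 0 <= t <= 1 ->
  `|response u t| <= C.
Proof.
have [C hC] := dotp_expmx_tail A b u 0; exists C => t t01.
by have := hC t t01; rewrite big_ord0 subr0 mulr1.
Qed.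

Lemma integrable_responseM u w T : T <= 1 ->
  mu.-integrable `[0, T] (EFin \o (fun t => response u t * response w t)).
Proof.
move=> T1; have [C hC] := response_bounded u.
have [D hD] := response_bounded w.
apply: (@integrable_le _ _ _ (C * D)) => [|t /andP[t0 tT]].
  by apply: measurable_funM; exact: measurable_response.
have t01 : 0 <= t <= 1 by rewrite t0 (le_trans tT).
by rewrite normrM ler_pM // ?hC ?hD.
Qed.

Lemma Rintegral_lincomb (I : Type) (r : seq I) (c : I -> R) (h : I -> R -> R) T :
  (forall i, mu.-integrable `[0, T] (EFin \o h i)) ->
  \int[mu]_(t in `[0, T]) (\sum_(i <- r) c i * h i t) =
  \sum_(i <- r) c i * \int[mu]_(t in `[0, T]) h i t.
Proof.
move=> ih; have ihc i : mu.-integrable `[0, T] (EFin \o (fun t => c i * h i t)).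
  by have := integrableZl _ (c i) (ih i); apply.
suff : \int[mu]_(t in `[0, T]) (\sum_(i <- r) c i * h i t) =
    \sum_(i <- r) c i * \int[mu]_(t in `[0, T]) h i t /\
    mu.-integrable `[0, T] (EFin \o (fun t => \sum_(i <- r) c i * h i t)).
  by case.
elim: r => [|i r [IH ir]].
  have -> : (fun t => \sum_(j <- [::]) c j * h j t) = cst 0.
    by apply/funext => t; rewrite big_nil.
  rewrite big_nil Rintegral_cst ?mul0r //; split=> //.
  by apply: (@integrable_le _ _ _ 0) => // t _; rewrite normr0.
have -> : (fun t => \sum_(j <- i :: r) c j * h j t) =
    (fun t => c i * h i t + \sum_(j <- r) c j * h j t).
  by apply/funext => t; rewrite big_cons.
split; first by rewrite RintegralD // RintegralZl // IH big_cons.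
by have := integrableD _ (ihc i) ir; apply.
Qed.

Lemma gramian_form u w T : T <= 1 ->
  dotp u (gramian A b T *m w) =
  \int[mu]_(t in `[0, T]) (response u t * response w t).
Proof.
move=> T1; pose e (i : 'I_n) : 'cV[R]_n := delta_mx i 0.
have eE i (x : 'cV[R]_n) : dotp (e i) x = x i 0.
  rewrite /dotp (bigD1 i) //= big1 ?addr0 ?mxE ?eqxx ?mul1r // => j ji.
  by rewrite mxE (negPf ji) /= mul0r.
have GE i j : gramian A b T i j =
    \int[mu]_(t in `[0, T]) (response (e i) t * response (e j) t).
  rewrite mxE; apply: eq_Rintegral => t _; rewrite expmx_trmx -mulmxA -trmx_mul.
  by rewrite mxE big_ord1 /response !eE [X in _ * X]mxE (ord1 ord0).
transitivity (\sum_(p : 'I_n * 'I_n) (u p.1 0 * w p.2 0) *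
    \int[mu]_(t in `[0, T]) (response (e p.1) t * response (e p.2) t)).
  rewrite -(pair_bigA _ (fun i j => (u i 0 * w j 0) *
     \int[mu]_(t in `[0, T]) (response (e i) t * response (e j) t))) /=.
  rewrite [LHS]/dotp; apply: eq_bigr => i _; rewrite mxE mulr_sumr; apply: eq_bigr => j _.
  by rewrite GE mulrA mulrAC.
rewrite -Rintegral_lincomb; last by move=> p; exact: integrable_responseM.
apply: eq_Rintegral => t _.
rewrite -(pair_bigA _ (fun i j => (u i 0 * w j 0) *
     (response (e i) t * response (e j) t))) /=.
rewrite /response [in RHS]/dotp mulr_suml; apply: eq_bigr => i _.
by rewrite mulr_sumr; apply: eq_bigr => j _; rewrite !eE mulrACA.
Qed.

Lemma trmx_gramian T : (gramian A b T)^T = gramian A b T.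
Proof.
apply/matrixP => i j; rewrite !mxE; apply: eq_Rintegral => t _.
by rewrite expmx_trmx -mulmxA -trmx_mul !mxE !big_ord1 !mxE mulrC.
Qed.

Hypothesis hAb : kalman A b.
Notation q := (krylov_basis A b).
Notation d := (krylov_coef A b).

(** [lead] and [drift] are the first two Taylor data of the response along q_i,
    which is lead i * t^i * (1 + drift i * t + O(t^2)). *)
Definition lead i : R := d i / i`!%:R.
Definition drift i : R := (\sum_(j < i.+1) ritz A b j) / i.+1%:R.

Lemma response_krylov i : (i < n)%N -> exists C : R, forall t, 0 <= t <= 1 ->
  `|response (q i) t - lead i * (t ^+ i + drift i * t ^+ i.+1)| <= C * t ^+ i.+2.
Proof.
move=> iN; have [C hC] := dotp_expmx_tail A b (q i) i.+2; exists C => t t01.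
suff <- : \sum_(k < i.+2) t ^+ k / k`!%:R * dotp (q i) (A ^+ k *m b) =
    lead i * (t ^+ i + drift i * t ^+ i.+1) by exact: hC.
rewrite big_ord_recr big_ord_recr /= big1 ?add0r => [|k _]; last first.
  by rewrite (krylov_orthogonal hAb) ?mulr0.
rewrite -!/(krylov A b _) (krylov_next hAb) // -/(d i) /lead /drift factS natrM.
by field; rewrite nat1r !pnatr_eq0 -!lt0n fact_gt0.
Qed.

Lemma gramian_krylov i j : (i < n)%N -> (j < n)%N -> exists C : R,
  forall T, 0 < T -> T <= 1 ->
  `|dotp (q i) (gramian A b T *m q j)
    - T ^+ (i + j).+1 * (lead i * lead j *
        ((i + j).+1%:R^-1 + T * ((drift i + drift j) / (i + j).+2%:R)))|
  <= C * T ^+ (i + j).+3.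
Proof.
move=> iN jN; have [C hC] := response_krylov iN.
have [D hD] := response_krylov jN.
set a := lead i; set c := lead j; set s := drift i; set r := drift j.
exists (C * (`|c| * (1 + `|r|)) + `|a| * (1 + `|s|) * D + C * D + `|a * c * s * r|).
move=> T T0 T1; rewrite gramian_form //.
have -> : T ^+ (i + j).+1 * (a * c * ((i + j).+1%:R^-1 + T * ((s + r) / (i + j).+2%:R)))
    = a * c * (T ^+ (i + j).+1 / (i + j).+1%:R) +
      a * c * (s + r) * (T ^+ (i + j).+2 / (i + j).+2%:R).
  by rewrite [T ^+ (i + j).+2]exprS; ring.
apply: integral_expansion => // [|t t01].
  by apply: measurable_funM; exact: measurable_response.
have [t0 t1] := andP t01.
set f := response (q i) t; set g := response (q j) t.
set p1 := a * (t ^+ i + s * t ^+ i.+1); set p2 := c * (t ^+ j + r * t ^+ j.+1).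
have -> : f * g - (a * c * t ^+ (i + j) + a * c * (s + r) * t ^+ (i + j).+1) =
    (f - p1) * p2 + p1 * (g - p2) + (f - p1) * (g - p2)
    + a * c * s * r * (t ^+ i.+1 * t ^+ j.+1).
  by rewrite /p1 /p2 ?exprS exprD; ring.
have pB (x y : R) k : `|x * (t ^+ k + y * t ^+ k.+1)| <= `|x| * (1 + `|y|) * t ^+ k.
  rewrite exprS -[X in x * (X + _)]mul1r mulrA -mulrDl mulrA !normrM.
  rewrite (ger0_norm (exprn_ge0 _ t0)) ler_wpM2r ?exprn_ge0 // ler_wpM2l //.
  rewrite (le_trans (ler_normD _ _)) // normr1 lerD2l normrM (ger0_norm t0).
  by rewrite ler_piMr.
have one : 0 <= (1 : R) <= (1 : R) by rewrite ler01 lexx.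
have C0 : 0 <= C by have := le_trans (normr_ge0 _) (hC 1 one); rewrite expr1n mulr1.
have D0 : 0 <= D by have := le_trans (normr_ge0 _) (hD 1 one); rewrite expr1n mulr1.
have f1 : `|f - p1| <= C * t ^+ i.+2 by exact: hC.
have g1 : `|g - p2| <= D * t ^+ j.+2 by exact: hD.
have e1 : t ^+ (i + j).+2 = t ^+ i * t ^+ j * t ^+ 2 by rewrite -!exprD addn2.
have e0 : 0 <= t ^+ i * t ^+ j * t ^+ 2 by rewrite -e1 exprn_ge0.
have lenD (x y z w : R) : `|x| <= z -> `|y| <= w -> `|x + y| <= z + w.
  by move=> h k; rewrite (le_trans (ler_normD _ _)) // lerD.
rewrite [leRHS]mulrDl [X in _ <= X + _]mulrDl [X in _ <= X + _ + _]mulrDl.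
apply: (lenD); first (apply: (lenD); first apply: (lenD)).
- rewrite normrM (le_trans (ler_pM _ _ f1 (pB c r j))) //.
  by rewrite e1 !exprS le_eqVlt; apply/orP; left; apply/eqP; ring.
- rewrite normrM (le_trans (ler_pM _ _ (pB a s i) g1)) //.
  by rewrite e1 !exprS le_eqVlt; apply/orP; left; apply/eqP; ring.
- rewrite normrM (le_trans (ler_pM _ _ f1 g1)) //.
  rewrite [leLHS](_ : _ = (C * D * t ^+ 2) * (t ^+ i * t ^+ j * t ^+ 2)); last first.
    by rewrite !exprS; ring.
  by rewrite e1 ler_wpM2r // ler_piMr ?mulr_ge0 // exprn_ile1.
- by rewrite normrM -exprD addSn addnS (ger0_norm (exprn_ge0 _ t0)).
Qed.

End Gramian.

(** * Shifted Legendre polynomials *)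

Section Legendre.
Variable R : realFieldType.

(** The coefficient of s^j in the monic Legendre polynomial of degree i on
    [0, 1]. *)
Definition legendre i j : R :=
  (-1) ^+ (i + j) * ('C(i, j) * 'C(i + j, j))%:R / 'C(2 * i, i)%:R.

(** The integral over [0, 1] of s^m times the i-th Legendre polynomial. *)
Definition legendre_moment i m : R := \sum_(j < i.+1) legendre i j / (j + m).+1%:R.

Definition legendre_sqnorm i : R := (i`! ^ 4)%:R / ((2 * i)`! * (2 * i).+1`!)%:R.

Lemma fact_neq0 k : k`!%:R != 0 :> R.
Proof. by rewrite pnatr_eq0 -lt0n fact_gt0. Qed.

Lemma legendre_small i j : (i < j)%N -> legendre i j = 0.
Proof. by move=> ij; rewrite /legendre bin_small // mul0n mulr0 mul0r. Qed.

Lemma legendre_diag i : legendre i i = 1.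
Proof.
rewrite /legendre addnn -mul2n binn mul1n exprM sqrrN expr1n expr1n mul1r divff //.
by rewrite pnatr_eq0 -lt0n bin_gt0 leq_pmull.
Qed.

Lemma legendre_subdiag i : legendre i.+1 i = - (i.+1%:R / 2).
Proof.
have e : 'C(2 * i.+1, i.+1) = (2 * 'C(i.+1 + i, i))%N.
  have -> : (2 * i.+1 = (i.+1 + i).+1)%N by lia.
  have := @bin_sub (i.+1 + i) i.+1 (leq_addr _ _); rewrite addKn => h.
  by rewrite binS -h addnn mul2n.
have c0 : 'C(i.+1 + i, i)%:R != 0 :> R.
  by rewrite pnatr_eq0 -lt0n bin_gt0 leq_addl.
rewrite /legendre e binSn !natrM -signr_odd addSn addnn /= odd_double expr1.
by rewrite -addnn -addSn; field.
Qed.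

Lemma prod_falling m k : (k <= m)%N ->
  (\prod_(l < k) (m%:R - l%:R)) * (m - k)`!%:R = m`!%:R :> R.
Proof.
elim: k => [|k IH] km; first by rewrite big_ord0 mul1r subn0.
rewrite big_ord_recr /= -IH ?(ltnW km) // -mulrA; congr (_ * _).
by rewrite -natrB ?(ltnW km) // -natrM -(subnSK km) factS.
Qed.

Lemma prod_rising m k :
  m`!%:R * (\prod_(l < k) (m%:R + l%:R + 1)) = (m + k)`!%:R :> R.
Proof.
elim: k => [|k IH]; first by rewrite big_ord0 mulr1 addn0.
rewrite big_ord_recr /= mulrA IH addnS (factS (m + k)).
by rewrite (natrM _ (m + k).+1) mulrC -natrD natr1.
Qed.

Lemma prod_others j k :
  \prod_(0 <= l < (j + k).+1 | l != j) (l%:R - j%:R) =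
  (-1) ^+ j * (j`!%:R * k`!%:R) :> R.
Proof.
elim: k => [|k IH].
  rewrite addn0 fact0 mulr1 big_mkcond big_nat_recr //= eqxx /= mulr1.
  transitivity (\prod_(0 <= l < j) (-1 * (j%:R - l%:R) : R)).
    rewrite big_nat_cond [RHS]big_nat_cond; apply: eq_bigr => l.
    by rewrite andbT => /= lj; rewrite ltn_eqF // mulN1r opprB.
  rewrite big_split /= prodr_const_nat subn0; congr (_ * _).
  rewrite big_mkord; have := prod_falling (leqnn j).
  by rewrite subnn fact0 mulr1.
rewrite big_mkcond addnS big_nat_recr //= -big_mkcond IH /=.
rewrite gtn_eqF ?ltnS ?leq_addr //= -!mulrA; congr (_ * (_ * _)).
by rewrite factS (natrM _ k.+1) mulrC -addnS natrD addrAC subrr add0r.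
Qed.

(** Partial fractions: as a function of m, the moment is a rational function with
    simple poles at -1, ..., -(i+1), and the Legendre coefficients are the
    residues of the right-hand side. The numerators agree because two polynomials
    of degree at most i that coincide at these i + 1 points are equal. *)
Lemma legendre_momentE i m : legendre_moment i m =
  (\prod_(l < i) (m%:R - l%:R)) / (\prod_(l < i.+1) (m%:R + l%:R + 1))
  / 'C(2 * i, i)%:R.
Proof.
pose c j : R := (-1) ^+ (i + j) * ('C(i, j) * 'C(i + j, j))%:R.
pose L : {poly R} := \prod_(l < i) ('X - l%:R%:P).
pose Q : {poly R} := \sum_(0 <= j < i.+1)
  c j *: \prod_(0 <= l < i.+1 | l != j) ('X - (- l.+1%:R)%:P).
have LQ : L = Q.
  apply/eqP; rewrite -subr_eq0; apply/eqP.
  pose s : seq R := [seq - j.+1%:R | j <- iota 0 i.+1].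
  apply: (@roots_geq_poly_eq0 _ _ s).
  - apply/allP => _ /mapP[j + ->]; rewrite mem_iota add0n /= => ji.
    rewrite rootE hornerD hornerN /L /Q horner_prod horner_sum subr_eq0; apply/eqP.
    transitivity ((-1) ^+ i * (\prod_(l < i) (j%:R + l%:R + 1)) : R).
      rewrite -[in (-1) ^+ i](card_ord i) -prodr_const -big_split /=.
      by apply: eq_bigr => l _; rewrite !hornerE -natr1; ring.
    rewrite (bigD1_seq j) ?mem_index_iota ?iota_uniq //= [X in _ + X]big1; last first.
      move=> k kj; rewrite hornerZ horner_prod.
      apply/eqP; rewrite mulf_eq0 prodf_seq_eq0; apply/orP; right; apply/hasP.
      exists j; rewrite ?mem_index_iota // hornerXsubC subrr eqxx andbT.
      by rewrite eq_sym.
    rewrite addr0 hornerZ horner_prod.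
    have -> : \prod_(0 <= l < i.+1 | l != j) ('X - (- l.+1%:R)%:P).[- j.+1%:R] =
       \prod_(0 <= l < i.+1 | l != j) (l%:R - j%:R) :> R.
      by apply: eq_bigr => l _; rewrite !hornerE -!natr1; ring.
    have h1 := prod_rising j i.
    have h2 : 'C(i + j, j)%:R * (j`!%:R * i`!%:R) = (j + i)`!%:R :> R.
      by rewrite -(natrM _ j`!) -natrM addnC -(bin_fact (leq_addr i j)) addKn.
    have h3 : 'C(i, j)%:R * (j`!%:R * (i - j)`!%:R) = i`!%:R :> R.
      by rewrite -(natrM _ j`!) -natrM bin_fact.
    (* The denominator of the residue at -(j+1). *)
    have h4 := prod_others j (i - j); rewrite subnKC // in h4.
    rewrite {}h4 /c (natrM _ 'C(i, j)).
    have h0 := fact_neq0 j; apply: (mulfI h0); rewrite mulrCA {}h1 -{}h2 -{}h3.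
    have h5 : (-1) ^+ j * (-1) ^+ j = 1 :> R.
      by rewrite -exprD addnn -mul2n exprM sqrrN expr1n expr1n.
    rewrite exprD; move: h5.
    move: (j`!%:R : R) ((i - j)`!%:R : R) ((-1) ^+ i : R) ((-1) ^+ j : R) => x y z w h5.
    move: ('C(i, j)%:R : R) ('C(i + j, j)%:R : R) => u v.
    rewrite [RHS](_ : _ = z * (v * (x * (u * (x * y)))) * (w * w)); last by ring.
    by rewrite h5 mulr1.
  - rewrite map_inj_uniq ?iota_uniq // => k l /oppr_inj/eqP.
    by rewrite eqr_nat eqSS => /eqP.
  - rewrite size_map size_iota (leq_trans (size_polyD _ _)) // size_polyN geq_max.
    rewrite /L -(big_mkord xpredT (fun l => 'X - l%:R%:P)) size_prod_XsubC.
    rewrite size_iota subn0 leqnn /=.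
    rewrite /Q (leq_trans (size_sum _ _ _)) //; apply/bigmax_leqP_seq => j.
    rewrite mem_index_iota /= => ji _; rewrite (leq_trans (size_scale_leq _ _)) //.
    rewrite -big_filter size_prod_XsubC -rem_filter ?iota_uniq //.
    by rewrite size_rem ?mem_index_iota // size_iota.
have EL : L.[m%:R] = \prod_(l < i) (m%:R - l%:R).
  by rewrite horner_prod; apply: eq_bigr => l _; rewrite hornerXsubC.
rewrite -EL LQ /Q horner_sum big_mkord !mulr_suml; apply: eq_bigr => j _.
have den (l : nat) : m%:R + l%:R + 1 != 0 :> R.
  by rewrite -natrD natr1 pnatr_eq0.
have -> : \prod_(l < i.+1) (m%:R + l%:R + 1 : R) =
    (m%:R + j%:R + 1) * \prod_(0 <= l < i.+1 | l != j) (m%:R + l%:R + 1).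
  by rewrite big_mkord (bigD1 j).
rewrite hornerZ horner_prod.
under eq_bigr do rewrite hornerXsubC opprK -natr1 addrA.
have r0 : \prod_(0 <= l < i.+1 | l != j) (m%:R + l%:R + 1) != 0 :> R.
  by rewrite big_mkord; apply/prodf_neq0 => l _.
rewrite /legendre -/(c j) -natr1 natrD addrAC [j%:R + _ + _]addrAC.
have e : j%:R + m%:R + 1 = m%:R + j%:R + 1 :> R by ring.
rewrite e; have dj := den j.
have c0 : 'C(2 * i, i)%:R != 0 :> R.
  by rewrite pnatr_eq0 -lt0n bin_gt0 leq_pmull.
by field; rewrite r0 dj c0.
Qed.

Lemma legendre_moment_lt i m : (m < i)%N -> legendre_moment i m = 0.
Proof.
move=> mi; rewrite legendre_momentE (bigD1 (Ordinal mi)) //=.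
by rewrite subrr !mul0r.
Qed.

Lemma legendre_moment_ge i m : (i <= m)%N -> legendre_moment i m =
  (m`!%:R ^+ 2 * i`!%:R ^+ 2) / ((m - i)`!%:R * (m + i).+1`!%:R * (2 * i)`!%:R).
Proof.
move=> im; rewrite legendre_momentE.
have h1 := prod_falling im; have h2 := prod_rising m i.+1; rewrite addnS in h2.
have h3 : 'C(2 * i, i)%:R * (i`!%:R * i`!%:R) = (2 * i)`!%:R :> R.
  rewrite -(natrM _ i`!) -natrM -(@bin_fact (2 * i) i) ?leq_pmull //.
  by rewrite mul2n -addnn addnK.
rewrite -{}h2 -{}h3; have m0 := fact_neq0 m; have i0 := fact_neq0 i.
have p0 : \prod_(l < i.+1) (m%:R + l%:R + 1) != 0 :> R.
  by apply/prodf_neq0 => l _; rewrite -natrD natr1 pnatr_eq0.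
have c0 : 'C(2 * i, i)%:R != 0 :> R.
  by rewrite pnatr_eq0 -lt0n bin_gt0 leq_pmull.
have mi0 := fact_neq0 (m - i).
move: h1 m0 i0 p0 c0 mi0.
move: (m`!%:R : R) (i`!%:R : R) ((m - i)`!%:R : R) ('C(2 * i, i)%:R : R) => x y z w.
move: (\prod_(l < i.+1) _) (\prod_(l < i) _) => p r <- x0 y0 p0 w0 z0.
by field; rewrite p0 w0 y0 z0; move: x0; rewrite mulf_eq0 negb_or => /andP[->].
Qed.

Lemma legendre_moment_eq i : legendre_moment i i = legendre_sqnorm i.
Proof.
rewrite legendre_moment_ge // /legendre_sqnorm subnn fact0 mul1r natrX natrM.
by rewrite -exprD (addnn i) -(mul2n i); congr (_ / _); exact: mulrC.
Qed.

Lemma legendre_moment_next i :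
  legendre_moment i i.+1 = legendre_sqnorm i * (i.+1%:R / 2).
Proof.
rewrite -legendre_moment_eq !legendre_moment_ge ?leqnSn // subSnn subnn.
have -> : (i.+1 + i = (i + i).+1)%N by rewrite addSn.
rewrite fact0 -[1%N`!]/1%N (factS i) (factS (i + i).+1).
rewrite (natrM _ i.+1) (natrM _ (i + i).+2).
have -> : (i + i).+2%:R = 2 * i.+1%:R :> R by rewrite -natrM; congr _%:R; lia.
have h1 := fact_neq0 i; have h2 := fact_neq0 (2 * i); have h3 := fact_neq0 (i + i).+1.
have i0 : i.+1%:R != 0 :> R by rewrite pnatr_eq0.
move: h1 h2 h3 i0.
move: (i`!%:R : R) ((2 * i)`!%:R : R) ((i + i).+1`!%:R : R) (i.+1%:R : R) => x y z w.
by move=> x0 y0 z0 w0; field; rewrite y0 z0 w0.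
Qed.

Lemma legendre_sqnorm_gt0 i : 0 < legendre_sqnorm i.
Proof.
by rewrite divr_gt0 // ltr0n ?expn_gt0 ?muln_gt0 ?fact_gt0.
Qed.

Lemma sum_legendre n i (F : nat -> R) : (i < n)%N ->
  \sum_(j < n) legendre i j * F j = \sum_(j < i.+1) legendre i j * F j.
Proof.
move=> iN; rewrite [RHS](big_ord_widen n (fun j => legendre i j * F j)) //.
rewrite [RHS]big_mkcond; apply: eq_bigr => j _; case: ltnP => // ij.
by rewrite legendre_small ?mul0r.
Qed.

Lemma legendre_form n i (F : nat -> R) m : (i < n)%N ->
  \sum_(k < n) \sum_(l < n) F k * legendre i l / (k + l + m).+1%:R =
  \sum_(k < n) F k * legendre_moment i (k + m).
Proof.
move=> iN; apply: eq_bigr => k _.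
rewrite /legendre_moment -(@sum_legendre n i (fun l => (l + (k + m)).+1%:R^-1)) //.
rewrite mulr_sumr; apply: eq_bigr => l _; rewrite mulrA.
by congr (_ / _.+1%:R); lia.
Qed.

(** The Legendre polynomials diagonalise the Hilbert matrix. *)
Lemma legendre_orthogonal n i j : (i < n)%N -> (j < n)%N ->
  \sum_(k < n) \sum_(l < n) legendre i k * legendre j l / (k + l).+1%:R =
  if i == j then legendre_sqnorm i else 0.
Proof.
suff h i' j' : (i' <= j')%N -> (j' < n)%N ->
    \sum_(k < n) \sum_(l < n) legendre i' k * legendre j' l / (k + l).+1%:R =
    if i' == j' then legendre_sqnorm i' else 0.
  move=> iN jN; case: (leqP i j) => ij; first exact: h.
  rewrite exchange_big eq_sym.
  under eq_bigr do under eq_bigr do rewrite [legendre i _ * _]mulrC addnC.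
  rewrite h // 1?ltnW //; by case: eqP => [->|].
move=> ij jN.
have := legendre_form (legendre i') 0 jN.
under eq_bigr do under eq_bigr do rewrite addn0.
move=> ->; under eq_bigr do rewrite addn0.
rewrite (@sum_legendre n i' (fun k => legendre_moment j' k)) ?(leq_ltn_trans ij) //.
rewrite big_ord_recr /= legendre_diag mul1r big1 ?add0r => [|k _]; last first.
  by rewrite legendre_moment_lt ?mulr0 // (leq_trans (ltn_ord k)).
case: eqP => [->|ne]; first by rewrite legendre_moment_eq.
by rewrite legendre_moment_lt // ltn_neqAle ij andbT; apply/eqP.
Qed.

(** The first-order response of the squared norm of the i-th Legendre polynomial
    to the perturbation s^j |-> s^j + T f_j s^(j+1) of the monomials: by
    orthogonality, only the two top coefficients contribute. *)
Lemma legendre_variation n i (f : nat -> R) : (i < n)%N ->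
  \sum_(k < n) \sum_(l < n)
    legendre i k * legendre i l * ((f k + f l) / (k + l).+2%:R) =
  legendre_sqnorm i * (i.+1%:R * f i - i%:R * f i.-1).
Proof.
move=> iN.
pose S := \sum_(k < n) \sum_(l < n)
  legendre i k * f k * legendre i l / (k + l + 1).+1%:R.
transitivity (S + S).
  rewrite {2}/S [X in _ = _ + X]exchange_big -big_split /=; apply: eq_bigr => k _.
  rewrite -big_split /=; apply: eq_bigr => l _.
  by rewrite !addn1 [(l + k)%N]addnC; ring.
rewrite /S; have /= -> := legendre_form (fun k => legendre i k * f k) 1 iN.
under eq_bigr do rewrite -mulrA.
rewrite (@sum_legendre n i (fun k => f k * legendre_moment i (k + 1))) //.
rewrite big_ord_recr /= legendre_diag addn1 legendre_moment_next.
case: i iN @S => [|i] iN S; first by rewrite big_ord0; field.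
rewrite big_ord_recr /= big1 ?add0r => [|k _]; last first.
  by rewrite legendre_moment_lt ?mulr0 // addn1 ltnS.
by rewrite legendre_subdiag addn1 legendre_moment_eq; field.
Qed.

End Legendre.

(** * Uniform asymptotics as T tends to 0+ *)

Section UniformBigO.
Variables (R : realType) (I : Type) (K : set I).
Implicit Types f g : R -> I -> R.

(** The parameter x is the rescaled eigenvalue mu when eigenvalues are located,
    and the point z in the final expansion. *)
Definition bigO m f := exists C : R, \forall T \near (0 : R)^'+,
  forall x, K x -> `|f T x| <= C * T ^+ m.

Lemma near_unit : \forall T \near (0 : R)^'+, 0 < T <= 1.
Proof.
near=> T; apply/andP; split; first by near: T; exact: nbhs_right_gt.
by near: T; exact: nbhs_right_le.
Unshelve. all: by end_near. Qed.

Lemma bigO_near m f g :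
  (\forall T \near (0 : R)^'+, forall x, K x -> g T x = f T x) ->
  bigO m f -> bigO m g.
Proof.
move=> fg [C hC]; exists C; near=> T => x Kx.
have -> : g T x = f T x by move: x Kx; near: T.
by move: x Kx; near: T.
Unshelve. all: by end_near. Qed.

Lemma bigO_ext m f g : (forall T x, g T x = f T x) -> bigO m f -> bigO m g.
Proof. by move=> fg; apply: bigO_near; apply: nearW => T x _. Qed.

Lemma bigO0 m : bigO m (fun _ _ => 0).
Proof. by exists 0; apply: nearW => T x _; rewrite normr0 mul0r. Qed.

Lemma bigOD m f g : bigO m f -> bigO m g -> bigO m (fun T x => f T x + g T x).
Proof.
move=> [C hC] [D hD]; exists (C + D); near=> T => x Kx.
rewrite (le_trans (ler_normD _ _)) // mulrDl lerD //; move: x Kx; near: T => //.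
Unshelve. all: by end_near. Qed.

Lemma bigON m f : bigO m f -> bigO m (fun T x => - f T x).
Proof. by move=> [C hC]; exists C; apply: filterS hC => T h x /h; rewrite normrN. Qed.

Lemma bigOB m f g : bigO m f -> bigO m g -> bigO m (fun T x => f T x - g T x).
Proof. by move=> hf hg; apply: bigOD => //; exact: bigON. Qed.

Lemma bigOM m p f g :
  bigO m f -> bigO p g -> bigO (m + p) (fun T x => f T x * g T x).
Proof.
move=> [C hC] [D hD]; exists (C * D); near=> T => x Kx.
rewrite normrM exprD mulrACA ler_pM //; move: x Kx; near: T => //.
Unshelve. all: by end_near. Qed.

Lemma bigO0M m f g : bigO 0 f -> bigO m g -> bigO m (fun T x => f T x * g T x).
Proof. exact: bigOM. Qed.

Lemma bigOM0 m f g : bigO m f -> bigO 0 g -> bigO m (fun T x => f T x * g T x).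
Proof. by move=> hf hg; rewrite -[m]addn0; exact: bigOM. Qed.

Lemma bigO_le m p f : (m <= p)%N -> bigO p f -> bigO m f.
Proof.
move=> mp [C hC]; exists `|C|; near=> T => x Kx.
have /andP[T0 T1] : 0 < T <= 1 by near: T; exact: near_unit.
apply: (@le_trans _ _ (C * T ^+ p)); first by move: x Kx; near: T.
apply: (@le_trans _ _ (`|C| * T ^+ p)).
  by rewrite ler_wpM2r ?ler_norm ?exprn_ge0 ?(ltW T0).
by rewrite ler_wpM2l // ler_wiXn2l // ltW.
Unshelve. all: by end_near. Qed.

Lemma bigO_cst c : bigO 0 (fun _ _ => c).
Proof. by exists `|c|; apply: nearW => T x _; rewrite mulr1. Qed.

Lemma bigO_param (c : I -> R) C : (forall x, K x -> `|c x| <= C) ->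
  bigO 0 (fun _ x => c x).
Proof. by move=> h; exists C; apply: nearW => T x /h; rewrite mulr1. Qed.

Lemma bigO_exprn m : bigO m (fun T _ => T ^+ m).
Proof.
exists 1; apply: filterS near_unit => T /andP[T0 _] x _.
by rewrite mul1r ger0_norm // exprn_ge0 // ltW.
Qed.

Lemma bigO_sum (J : Type) (r : seq J) (P : pred J) m (F : J -> R -> I -> R) :
  (forall j, P j -> bigO m (F j)) -> bigO m (fun T x => \sum_(j <- r | P j) F j T x).
Proof.
move=> hF; elim: r => [|j r IH].
  by apply: (bigO_ext _ (bigO0 m)) => T x; rewrite big_nil.
case Pj : (P j); last first.
  by apply: (bigO_ext _ IH) => T x; rewrite big_cons Pj.
apply: (bigO_ext _ (bigOD (hF j Pj) IH)) => T x.
by rewrite big_cons Pj.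
Qed.

Lemma bigO_prod (J : Type) (r : seq J) (P : pred J) (F : J -> R -> I -> R) :
  (forall j, P j -> bigO 0 (F j)) ->
  bigO 0 (fun T x => \prod_(j <- r | P j) F j T x).
Proof.
move=> hF; elim: r => [|j r IH].
  by apply: (bigO_ext _ (bigO_cst 1)) => T x; rewrite big_nil.
case Pj : (P j); last first.
  by apply: (bigO_ext _ IH) => T x; rewrite big_cons Pj.
apply: (bigO_ext _ (bigO0M (hF j Pj) IH)) => T x.
by rewrite big_cons Pj.
Qed.

Lemma bigO_prodB (J : Type) (r : seq J) m (F G : J -> R -> I -> R) :
  (forall j, bigO 0 (F j)) -> (forall j, bigO 0 (G j)) ->
  (forall j, bigO m (fun T x => F j T x - G j T x)) ->
  bigO m (fun T x => \prod_(j <- r) F j T x - \prod_(j <- r) G j T x).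
Proof.
move=> hF hG hFG; elim: r => [|j r IH].
  by apply: (bigO_ext _ (bigO0 m)) => T x; rewrite !big_nil subrr.
have := bigO_prod r (P := xpredT) (fun j _ => hG j) => hP.
apply: (bigO_ext _ (bigOD (bigO0M (hF j) IH) (bigOM0 (hFG j) hP))) => T x.
by rewrite !big_cons; ring.
Qed.

Lemma bigO1_small f (e : R) : 0 < e -> bigO 1 f ->
  \forall T \near (0 : R)^'+, forall x, K x -> `|f T x| < e.
Proof.
move=> e0 [C hC]; near=> T => x Kx.
have T0 : 0 < T by near: T; exact: nbhs_right_gt.
have TC : T < e / (`|C| + 1) by near: T; apply: nbhs_right_lt; rewrite divr_gt0 ?ltr_wpDl.
have C1 : 0 < `|C| + 1 by rewrite ltr_wpDl.
have h : `|f T x| <= C * T ^+ 1 by move: x Kx; near: T.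
rewrite (le_lt_trans h) // expr1.
rewrite ltr_pdivlMr // in TC; apply: le_lt_trans TC.
by rewrite mulrC ler_wpM2l ?(ltW T0) // (le_trans (ler_norm C)) // lerDl.
Unshelve. all: by end_near. Qed.

End UniformBigO.

(** A non-identical permutation moves at least two indices, so off-diagonal
    entries of size T only contribute T^2 to a determinant. *)
Lemma bigO_det (R : realType) (I : Type) (K : set I) n (Z : R -> I -> 'M[R]_n) :
  (forall i : 'I_n, bigO K 0 (fun T x => Z T x i i)) ->
  (forall i j, i != j -> bigO K 1 (fun T x => Z T x i j)) ->
  bigO K 2 (fun T x => \det (Z T x) - \prod_i Z T x i i).
Proof.
move=> hd ho.
have h0 i j : bigO K 0 (fun T x => Z T x i j).
  have [<-|ij] := eqVneq i j; first exact: hd.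
  exact: (bigO_le (leq0n 1) (ho i j ij)).
apply: (bigO_ext (f := fun T x => \sum_(s : 'S_n | s != 1%g)
    (-1) ^+ s * \prod_i Z T x i (s i))).
  move=> T x; rewrite /determinant (bigD1 1%g) //= odd_perm1 expr0 mul1r.
  by under eq_bigr do rewrite perm1; rewrite addrC addrK.
apply: bigO_sum => s s1; apply: bigO0M; first exact: bigO_cst.
have [i si] : exists i : 'I_n, s i != i.
  apply/existsP; apply: contraNT s1 => /existsPn h; apply/eqP/permP => i.
  by rewrite perm1; apply/eqP; move: (h i); rewrite negbK.
have sj : s (s i) != s i by rewrite (inj_eq perm_inj).
apply: (bigO_ext (f := fun T x => Z T x i (s i) * (Z T x (s i) (s (s i)) *
    \prod_(l | (l != i) && (l != s i)) Z T x l (s l)))).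
  by move=> T x; rewrite (bigD1 i) //= (bigD1 (s i)).
rewrite -[2%N]/(1 + (1 + 0))%N; apply: bigOM; first by apply: ho; rewrite eq_sym.
by apply: bigOM; [apply: ho; rewrite eq_sym|apply: bigO_prod].
Qed.

(** * The Gramian in the Legendre frame *)

Section GradedGramian.
Variables (R : realType) (n : nat) (A : 'M[R]_n) (b : 'cV[R]_n).
Hypothesis hAb : kalman A b.
Notation q := (krylov_basis A b).
Notation G := (gramian A b).
Notation lead := (lead A b).
Notation drift := (drift A b).

Lemma lead_gt0 i : (i < n)%N -> 0 < lead i.
Proof. by move=> iN; rewrite divr_gt0 ?(krylov_coef_gt0 hAb) ?ltr0n ?fact_gt0. Qed.

Lemma driftE i : i.+1%:R * drift i - i%:R * drift i.-1 = ritz A b i.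
Proof.
rewrite /drift mulrC divfK ?pnatr_eq0 // big_ord_recr /=.
case: i => [|i]; first by rewrite big_ord0 mul0r subr0 add0r.
by rewrite mulrC divfK ?pnatr_eq0 // addrAC subrr add0r.
Qed.

Lemma ellE i : ell A b i = lead i ^+ 2 * legendre_sqnorm R i.
Proof.
rewrite /ell /kappa /lead /legendre_sqnorm !natrX (natrM _ (2 * i).+1`!).
rewrite (natrM _ (2 * i)`!).
have := fact_neq0 R i; have := fact_neq0 R (2 * i).
have := fact_neq0 R (2 * i).+1.
move: (i`!%:R : R) ((2 * i)`!%:R : R) ((2 * i).+1`!%:R : R) => x y z z0 y0 x0.
by field; rewrite x0 y0 z0.
Qed.

Definition graded_coef i j : R := legendre R i j / lead j.

(** In the basis of Krylov vectors the Gramian has entries of size T^(i+j+1);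
    these combinations, which correspond to the shifted Legendre polynomials,
    diagonalise its leading part. *)
Definition graded_vec (T : R) i : 'cV[R]_n :=
  \sum_(j < n) (T ^+ (i - j) * graded_coef i j) *: q j.

(** [graded_gram] is the matrix of the identity and, up to the powers of T,
    [graded_form] that of G_T in the frame of the [graded_vec T i]. *)
Definition graded_gram T i j : R := dotp (graded_vec T i) (graded_vec T j).

Definition graded_form T i j : R :=
  dotp (graded_vec T i) (G T *m graded_vec T j) / T ^+ (i + j).+1.

Lemma graded_coef_small i j : (i < j)%N -> graded_coef i j = 0.
Proof. by move=> ij; rewrite /graded_coef legendre_small // mul0r. Qed.

Lemma graded_coef_diag i : graded_coef i i = (lead i)^-1.
Proof. by rewrite /graded_coef legendre_diag mul1r. Qed.

Lemma dotp_graded_vec T i j : (j < n)%N ->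
  dotp (graded_vec T i) (q j) = T ^+ (i - j) * graded_coef i j.
Proof.
move=> jN; rewrite dotp_suml (bigD1 (Ordinal jN)) //= big1 ?addr0 => [|l].
  by rewrite dotpZl (krylov_basis_orthonormal hAb) // eqxx mulr1.
rewrite -val_eqE /= => lj; rewrite dotpZl (krylov_basis_orthonormal hAb) //.
by rewrite (negPf lj) mulr0.
Qed.

Section Expansions.
Variables (I : Type) (K : set I).
Notation O m f := (bigO K m (fun T (_ : I) => f T)).

Lemma bigO_monomial m p (c : R) : (c != 0 -> (m <= p)%N) ->
  O m (fun T => T ^+ p * c).
Proof.
have [-> _|c0 /(_ isT) mp] := eqVneq c 0.
  by apply: (bigO_ext _ (bigO0 R K m)) => T x; rewrite mulr0.
apply: (bigO_le mp).
by apply: bigOM0; [exact: bigO_exprn|exact: bigO_cst].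
Qed.

Lemma graded_gramE T i j : graded_gram T i j =
  \sum_(l < n) T ^+ ((i - l) + (j - l)) * (graded_coef i l * graded_coef j l).
Proof.
rewrite /graded_gram dotpC dotp_suml; apply: eq_bigr => l _.
by rewrite dotpZl dotpC dotp_graded_vec // exprD; ring.
Qed.

(** For l <= min(i, j) the exponent (i - l) + (j - l) of T vanishes only if
    i = l = j. *)
Lemma graded_gram_offdiag i j : i != j -> O 1 (fun T => graded_gram T i j).
Proof.
move=> ij; apply: (bigO_ext (fun T _ => graded_gramE T i j)).
apply: bigO_sum => l _; apply: bigO_monomial => c0.
rewrite lt0n addn_eq0 !subn_eq0; apply: contra_neqN ij => /andP[il jl].
move: c0; rewrite mulf_eq0 negb_or => /andP[c1 c2].
suff : (l <= i)%N && (l <= j)%N by lia.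
apply/andP; split; rewrite leqNgt.
  by apply: contraNN c1 => /graded_coef_small ->.
by apply: contraNN c2 => /graded_coef_small ->.
Qed.

Lemma graded_gram_diag i : (i < n)%N ->
  O 2 (fun T => graded_gram T i i - (lead i)^-1 ^+ 2).
Proof.
move=> iN; apply: (bigO_ext (f := fun T _ => \sum_(l < n | l != Ordinal iN)
   T ^+ ((i - l) + (i - l)) * (graded_coef i l * graded_coef i l))).
  move=> T _; rewrite graded_gramE (bigD1 (Ordinal iN)) //= subnn mul1r.
  by rewrite graded_coef_diag expr2 addrAC subrr add0r.
apply: bigO_sum => l li; apply: bigO_monomial => c0.
have : (l <= i)%N.
  by rewrite leqNgt; apply: contraNN c0 => /graded_coef_small ->; rewrite mul0r.
by move: li; rewrite -val_eqE /=; lia.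
Qed.

Definition form_drift i j : R := \sum_(k < n) \sum_(l < n)
  legendre R i k * legendre R j l * ((drift k + drift l) / (k + l).+2%:R).

Lemma gramian_krylov_bigO k l : (k < n)%N -> (l < n)%N ->
  O 2 (fun T => dotp (q k) (G T *m q l) / T ^+ (k + l).+1
    - lead k * lead l *
      ((k + l).+1%:R^-1 + T * ((drift k + drift l) / (k + l).+2%:R))).
Proof.
move=> kN lN; have [C hC] := gramian_krylov hAb kN lN; exists C.
apply: filterS (@near_unit R) => T /andP[T0 T1] _ _.
have p0 : 0 < T ^+ (k + l).+1 by rewrite exprn_gt0.
rewrite -(ler_pM2r p0) -[X in _ * X <= _](gtr0_norm p0) -normrM mulrBl divfK ?gt_eqF //.
rewrite [leRHS](_ : _ = C * T ^+ (k + l).+3) 1?[X in _ - X]mulrC ?hC //.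
by rewrite -mulrA -exprD add2n.
Qed.

(** For k <= i and l <= j, the factor T^(i-k) T^(j-l) of the frame and the factor
    T^(k+l+1) of the Krylov entry multiply to T^(i+j+1), which disappears from
    [graded_form]. *)
Lemma graded_form_expansion i j : (i < n)%N -> (j < n)%N ->
  O 2 (fun T => graded_form T i j
    - ((if i == j then legendre_sqnorm R i else 0) + T * form_drift i j)).
Proof.
move=> iN jN; apply: (bigO_near (f := fun T _ => \sum_(k < n) \sum_(l < n)
   graded_coef i k * graded_coef j l *
   (dotp (q k) (G T *m q l) / T ^+ (k + l).+1 - lead k * lead l *
      ((k + l).+1%:R^-1 + T * ((drift k + drift l) / (k + l).+2%:R))))).
  apply: filterS (@near_unit R) => T /andP[T0 _] _ _.
  rewrite /graded_form /graded_vec dotp_suml mulr_suml.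
  rewrite -(legendre_orthogonal R iN jN) /form_drift mulr_sumr -big_split.
  rewrite -sumrB; apply: eq_bigr => k _.
  rewrite mulmx_sumr dotp_sumr mulr_suml mulr_sumr -big_split -sumrB.
  apply: eq_bigr => l _ /=; rewrite -scalemxAr dotpZl dotpZr.
  have [ki|ik] := leqP k i; last first.
    by rewrite legendre_small // (graded_coef_small ik) !(mul0r, mulr0, subr0, addr0).
  have [lj|jl] := leqP l j; last first.
    by rewrite (legendre_small _ jl) (graded_coef_small jl)
      !(mul0r, mulr0, subr0, addr0).
  have -> : (i + j).+1 = ((i - k) + (j - l) + (k + l).+1)%N by lia.
  rewrite !exprD /graded_coef.
  have k0 := lead_gt0 (ltn_ord k); have l0 := lead_gt0 (ltn_ord l).
  have h1 : T ^+ (i - k) != 0 by rewrite gt_eqF ?exprn_gt0.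
  have h2 : T ^+ (j - l) != 0 by rewrite gt_eqF ?exprn_gt0.
  have h3 : T ^+ (k + l).+1 != 0 by rewrite gt_eqF ?exprn_gt0.
  move: h1 h2 h3.
  move: (T ^+ (i - k)) (T ^+ (j - l)) (T ^+ (k + l).+1) => x y z x0 y0 z0.
  have h4 : (k + l).+1%:R != 0 :> R by rewrite pnatr_eq0.
  have h5 : (k + l).+2%:R != 0 :> R by rewrite pnatr_eq0.
  move: ((k + l).+1%:R : R) ((k + l).+2%:R : R) h4 h5 => u v u0 v0.
  by field; rewrite x0 y0 z0 u0 v0 !gt_eqF.
apply: bigO_sum => k _; apply: bigO_sum => l _.
by apply: bigO0M; [exact: bigO_cst|exact: gramian_krylov_bigO].
Qed.

Lemma graded_form_offdiag i j : (i < n)%N -> (j < n)%N -> i != j ->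
  O 1 (fun T => graded_form T i j).
Proof.
move=> iN jN ij.
have h1 := bigO_le (isT : 1 <= 2)%N (graded_form_expansion iN jN).
have h2 : O 1 (fun T => T ^+ 1 * form_drift i j) by apply: bigO_monomial.
apply: (bigO_ext _ (bigOD h1 h2)) => T x.
by rewrite (negPf ij) add0r subrK.
Qed.

Lemma graded_form_diag2 i : (i < n)%N -> O 2 (fun T => graded_form T i i -
    legendre_sqnorm R i * (1 + ritz A b i * T)).
Proof.
move=> iN; apply: (bigO_ext _ (graded_form_expansion iN iN)) => T x.
by rewrite eqxx /form_drift legendre_variation // driftE; ring.
Qed.

Lemma graded_form_diag i : (i < n)%N ->
  O 1 (fun T => graded_form T i i - legendre_sqnorm R i).
Proof.
move=> iN; have h1 := bigO_le (isT : 1 <= 2)%N (graded_form_diag2 iN).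
have h2 : O 1 (fun T => T ^+ 1 * (legendre_sqnorm R i * ritz A b i)).
  exact: bigO_monomial.
by apply: (bigO_ext _ (bigOD h1 h2)) => T x; ring.
Qed.

End Expansions.

End GradedGramian.

(** * Localisation of one eigenvalue *)

Lemma char_poly_horner (R : comNzRingType) n (M : 'M[R]_n) x :
  (char_poly M).[x] = \det (x%:M - M).
Proof.
rewrite -[LHS]/(horner_eval x (\det (char_poly_mx M))) -det_map_mx.
congr (\det _); apply/matrixP => i j.
by rewrite /char_poly_mx !mxE /= /horner_eval !hornerE; case: (i == j);
  rewrite ?hornerX ?horner0.
Qed.

Lemma poly_sign_root (R : rcfType) (p : {poly R}) (x y : R) : x <= y ->
  p.[x] * p.[y] < 0 -> exists2 z, x <= z <= y & root p z.
Proof.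
move=> xy; case: (ltP p.[x] 0) => px pxy.
  have py : 0 <= p.[y].
    by rewrite leNgt; apply: contraTN pxy => py; rewrite -leNgt mulr_le0 // ltW.
  have pxy0 : p.[x] <= 0 <= p.[y] by rewrite (ltW px) py.
  have [z xzy rz] := poly_ivt xy pxy0; exists z; [exact: xzy|exact: rz].
have py : p.[y] <= 0.
  by rewrite leNgt; apply: contraTN pxy => py; rewrite -leNgt mulr_ge0 // ltW.
have pxy0 : (- p).[x] <= 0 <= (- p).[y].
  by rewrite !hornerN oppr_le0 px oppr_ge0 py.
have [z xzy rz] := poly_ivt xy pxy0; exists z; first exact: xzy.
by rewrite -rootN; exact: rz.
Qed.

Lemma mulmx_frame (R : realType) n (f : 'I_n -> 'cV[R]_n) (M : 'M[R]_n) i j :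
  let B := \matrix_(i, l) f i l 0 in
  (B *m M *m B^T) i j = dotp (f i) (M *m f j).
Proof.
rewrite /= -mulmxA mxE; apply: eq_bigr => l _; rewrite !mxE; congr (_ * _).
by apply: eq_bigr => p _; rewrite !mxE.
Qed.

Section Pencil.
Variables (R : realType) (n : nat) (A : 'M[R]_n) (b : 'cV[R]_n).
Hypothesis hAb : kalman A b.
Variable k : 'I_n.
Notation q := (krylov_basis A b).
Notation G := (gramian A b).
Notation lead := (lead A b).
Notation h := (legendre_sqnorm R).
Notation lk := (ell A b k).

(** A neighbourhood of the expected limit ell_k of lambda_k / T^(2k+1), which
    stays away from 0. *)
Definition pencil_range : set R := [set mu | lk / 2 <= mu <= 3 / 2 * lk].
Notation K := pencil_range.

(** The matrix of T^(2k+1) mu - G_T in the rescaled frame [frame], divided by T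
    ([frame_mxE]). The exponents are truncated subtractions: T^((k-i)+(k-j))
    damps the rows and columns before k in the first term, T^((i-k)+(j-k)) those
    after k in the second one. *)
Definition pencil (T mu : R) : 'M[R]_n := \matrix_(i, j)
  (mu * (T ^+ ((k - i) + (k - j)) * graded_gram A b T i j)
   - T ^+ ((i - k) + (j - k)) * graded_form A b T i j).

Definition pencil_lim mu i : R :=
  (if (k <= i)%N then mu / lead i ^+ 2 else 0) - (if (i <= k)%N then h i else 0).

(** The exponent min(i, k) turns the graded sizes T^(i+j+1) of G_T and T^(2k+1) of
    the eigenvalue into bounded entries. *)
Definition frame T i : 'cV[R]_n := (T ^+ minn i k)^-1 *: graded_vec A b T i.

Definition frame_mx T : 'M[R]_n := \matrix_(i, j) frame T i j 0.

Lemma lk_gt0 : 0 < lk.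
Proof.
by rewrite ellE mulr_gt0 ?exprn_gt0 ?(lead_gt0 hAb) ?legendre_sqnorm_gt0.
Qed.

Lemma bigO_mu : @bigO R R K 0 (fun _ mu => mu).
Proof.
apply: (@bigO_param _ _ _ _ (3 / 2 * lk)) => mu /andP[m1 m2].
by rewrite ger0_norm // (le_trans _ m1) // divr_ge0 // ltW // lk_gt0.
Qed.

Lemma bigO_pow p : @bigO R R K 0 (fun (T _ : R) => T ^+ p).
Proof. exact: (bigO_le (leq0n p) (bigO_exprn R K p)). Qed.

Lemma pencil_offdiag (i j : 'I_n) : i != j -> @bigO R R K 1 (fun T mu => pencil T mu i j).
Proof.
move=> ij; apply: (bigO_ext (fun T mu => mxE _ _ _ _)).
apply: bigOB; [apply: (bigO0M bigO_mu)|]; apply: (bigO0M (bigO_pow _)).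
  by apply: (graded_gram_offdiag hAb).
by apply: (graded_form_offdiag hAb).
Qed.

Lemma gram_power (i : 'I_n) : @bigO R R K (if i == k then 2 else 1)
  (fun T (_ : R) =>
  T ^+ ((k - i) + (k - i)) * graded_gram A b T i i
  - (if (k <= i)%N then (lead i)^-1 ^+ 2 else 0)).
Proof.
have hd := graded_gram_diag hAb K (ltn_ord i).
case: leqP => ki.
  apply: (@bigO_le _ _ _ _ 2); first by case: ifP.
  apply: (bigO_ext _ hd) => T x.
  by move/eqP: ki => ->; rewrite mul1r.
rewrite ifF; last by rewrite -val_eqE /= ltn_eqF.
have h0 : @bigO R R K 0 (fun T (_ : R) => graded_gram A b T i i).
  have h1 := bigOD (bigO_le (leq0n 2) hd) (bigO_cst K ((lead i)^-1 ^+ 2)).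
  by apply: (bigO_ext _ h1) => T x; rewrite subrK.
have h1 : @bigO R R K 1 (fun T (_ : R) => T ^+ ((k - i) + (k - i))).
  by apply: (@bigO_le _ _ _ _ ((k - i) + (k - i))); [lia|exact: bigO_exprn].
by apply: (bigO_ext _ (bigOM h1 h0)) => T x; rewrite subr0.
Qed.

Lemma form_power (i : 'I_n) : @bigO R R K 1 (fun T (_ : R) =>
  T ^+ ((i - k) + (i - k)) * graded_form A b T i i
  - (if (i <= k)%N then h i else 0)).
Proof.
have hd := graded_form_diag hAb K (ltn_ord i).
case: leqP => ki.
  by apply: (bigO_ext _ hd) => T x; move/eqP: ki => ->; rewrite mul1r.
have h0 : @bigO R R K 0 (fun T (_ : R) => graded_form A b T i i).
  have h1 := bigOD (bigO_le (leq0n 1) hd) (bigO_cst K (h i)).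
  by apply: (bigO_ext _ h1) => T x; rewrite subrK.
have h1 : @bigO R R K 1 (fun T (_ : R) => T ^+ ((i - k) + (i - k))).
  by apply: (@bigO_le _ _ _ _ ((i - k) + (i - k))); [lia|exact: bigO_exprn].
by apply: (bigO_ext _ (bigOM h1 h0)) => T x; rewrite subr0.
Qed.

Lemma pencil_diag (i : 'I_n) :
  @bigO R R K 1 (fun T mu => pencil T mu i i - pencil_lim mu i).
Proof.
have h1 : @bigO R R K 1 (fun T _ => T ^+ ((k - i) + (k - i)) * graded_gram A b T i i
  - (if (k <= i)%N then (lead i)^-1 ^+ 2 else 0)).
  by apply: bigO_le (gram_power i); case: ifP.
apply: (bigO_ext _ (bigOB (bigO0M bigO_mu h1) (form_power i))) => T mu.
by rewrite mxE /pencil_lim -exprVn; case: ifP => _; ring.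
Qed.

(** The second-order information that yields the coefficient a_k. *)
Lemma pencil_pivot : @bigO R R K 2 (fun T mu => pencil T mu k k
  - (mu / lead k ^+ 2 - h k * (1 + ritz A b k * T))).
Proof.
have h1 := gram_power k; rewrite eqxx leqnn in h1.
have h2 := graded_form_diag2 hAb K (ltn_ord k).
apply: (bigO_ext _ (bigOB (bigO0M bigO_mu h1) h2)) => T mu.
by rewrite mxE !subnn -exprVn; ring.
Qed.

Lemma bigO_pencil_lim (i : 'I_n) : @bigO R R K 0 (fun _ mu => pencil_lim mu i).
Proof.
apply: bigOB; last exact: bigO_cst.
case: (k <= i)%N; last exact: bigO_cst.
by apply: (bigO0M bigO_mu); exact: bigO_cst.
Qed.

Lemma pencil_diag0 (i : 'I_n) : @bigO R R K 0 (fun T mu => pencil T mu i i).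
Proof.
have h1 := bigO_le (leq0n 1) (pencil_diag i).
by apply: (bigO_ext _ (bigOD h1 (bigO_pencil_lim i))) => T x; rewrite subrK.
Qed.

Lemma det_pencil2 :
  @bigO R R K 2 (fun T mu => \det (pencil T mu) - \prod_i pencil T mu i i).
Proof. exact: bigO_det pencil_diag0 pencil_offdiag. Qed.

Lemma det_pencil1 :
  @bigO R R K 1 (fun T mu => \det (pencil T mu) - \prod_(i < n) pencil_lim mu i).
Proof.
have h1 := bigO_le (isT : 1 <= 2)%N det_pencil2.
have h2 := bigO_prodB (index_enum 'I_n) pencil_diag0 bigO_pencil_lim pencil_diag.
by apply: (bigO_ext _ (bigOD h1 h2)) => T mu; rewrite addrA subrK.
Qed.

(** Half of a lower bound of |pencil_lim mu i| over [pencil_range], for i <> k. *)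
Definition pencil_gap (i : 'I_n) : R :=
  (if (k < i)%N then lk / 2 / lead i ^+ 2 else h i) / 2.

Lemma pencil_gap_gt0 i : 0 < pencil_gap i.
Proof.
rewrite divr_gt0 //; case: ifP => _; last exact: legendre_sqnorm_gt0.
by rewrite !divr_gt0 ?exprn_gt0 ?(lead_gt0 hAb) ?lk_gt0.
Qed.

Lemma pencil_lim_ge (i : 'I_n) mu : i != k -> K mu ->
  2 * pencil_gap i <= `|pencil_lim mu i|.
Proof.
rewrite -val_eqE /pencil_gap /pencil_lim /= mulrC divfK // => ik /andP[m1 _].
have l0 : 0 < lead i ^+ 2 by rewrite exprn_gt0 ?(lead_gt0 hAb).
case: (ltngtP i k) ik => // ik _.
  by rewrite sub0r normrN ger0_norm // ltW // legendre_sqnorm_gt0.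
rewrite subr0 ger0_norm ?ler_pM2r ?invr_gt0 // divr_ge0 ?(ltW l0) //.
by rewrite (le_trans _ m1) // divr_ge0 // ltW // lk_gt0.
Qed.

Lemma pencil_diag_ge (i : 'I_n) : i != k ->
  \forall T \near (0 : R)^'+, forall mu, K mu -> pencil_gap i <= `|pencil T mu i i|.
Proof.
move=> ik; apply: filterS (bigO1_small (pencil_gap_gt0 i) (pencil_diag i)).
move=> T hT mu Kmu; have h1 := hT mu Kmu; have h2 := pencil_lim_ge ik Kmu.
have := ler_normB (pencil T mu i i) (pencil T mu i i - pencil_lim mu i).
rewrite opprB addrCA subrr addr0 => h3; lra.
Qed.

Lemma pencil_diag_ge_all : \forall T \near (0 : R)^'+, forall i : 'I_n, i != k ->
  forall mu, K mu -> pencil_gap i <= `|pencil T mu i i|.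
Proof.
apply: filter_forall => i; have [->|ik] := eqVneq i k.
  by apply: nearW => T.
by apply: filterS (pencil_diag_ge ik) => T hT _.
Qed.

Lemma frame_mxE T mu : 0 < T ->
  frame_mx T *m ((T ^+ (2 * k).+1 * mu)%:M - G T) *m (frame_mx T)^T
  = T *: pencil T mu.
Proof.
move=> T0; apply/matrixP => i j; rewrite mulmx_frame mulmxBl mul_scalar_mx.
rewrite dotpBr dotpZr /frame -scalemxAr !dotpZr !dotpZl !mxE /graded_form.
rewrite -/(graded_gram A b T i j).
have -> : (2 * k).+1 = (minn i k + minn j k + (k - i + (k - j))).+1 by lia.
have -> : (i + j).+1 = (minn i k + minn j k + (i - k + (j - k))).+1 by lia.
rewrite !exprS !exprD.
have p1 p : T ^+ p != 0 by rewrite gt_eqF ?exprn_gt0.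
have := p1 (minn i k); have := p1 (minn j k); have := p1 (i - k)%N.
have := p1 (j - k)%N; have : T != 0 by rewrite gt_eqF.
move: (T ^+ minn i k) (T ^+ minn j k) (T ^+ (i - k)) (T ^+ (j - k)).
move=> x y z w T1 w0 z0 y0 x0.
by field; rewrite x0 y0 z0 w0 T1.
Qed.

Lemma dotp_frame T i j : (j < n)%N ->
  dotp (frame T i) (q j) = (T ^+ minn i k)^-1 * (T ^+ (i - j) * graded_coef A b i j).
Proof. by move=> jN; rewrite dotpZl dotp_graded_vec. Qed.

Lemma frame_mx_unit T : 0 < T -> \det (frame_mx T) != 0.
Proof.
move=> T0; pose Q : 'M[R]_n := \matrix_(i, j) q j i 0.
have e i j : (frame_mx T *m Q) i j = dotp (frame T i) (q j).
  by rewrite mxE; apply: eq_bigr => l _; rewrite !mxE.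
suff : \det (frame_mx T *m Q) != 0.
  by rewrite det_mulmx mulf_eq0 negb_or => /andP[].
rewrite det_trig; last first.
  by apply/is_trig_mxP => i j ij; rewrite e dotp_frame // graded_coef_small // !mulr0.
apply/prodf_neq0 => i _; rewrite e dotp_frame // subnn mul1r graded_coef_diag.
by rewrite mulf_neq0 // invr_neq0 // gt_eqF ?exprn_gt0 ?(lead_gt0 hAb).
Qed.

Lemma char_poly_pencil T mu : 0 < T ->
  (char_poly (G T)).[T ^+ (2 * k).+1 * mu] * \det (frame_mx T) ^+ 2 =
  T ^+ n * \det (pencil T mu).
Proof.
move=> T0; rewrite -detZ -frame_mxE // !det_mulmx det_tr char_poly_horner expr2.
ring.
Qed.

(** At the two ends of [pencil_range] the factors with i <> k have the same sign,
    and those with i = k are - h_k / 2 and h_k / 2. *)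
Lemma pencil_ends :
  (\prod_(i < n) pencil_lim (lk / 2) i) *
  (\prod_(i < n) pencil_lim (3 / 2 * lk) i) < 0.
Proof.
have lE : lk / lead k ^+ 2 = h k.
  by rewrite ellE mulrAC divff ?mul1r // gt_eqF ?exprn_gt0 ?(lead_gt0 hAb).
rewrite -big_split (bigD1 k) //= nmulr_rlt0.
  apply: prodr_gt0 => i; rewrite -val_eqE /= => ik.
  have l0 : 0 < lead i ^+ 2 by rewrite exprn_gt0 ?(lead_gt0 hAb).
  rewrite /pencil_lim; case: (ltngtP i k) ik => // ik _.
    by rewrite !sub0r mulrNN mulr_gt0 ?legendre_sqnorm_gt0.
  have lp := lk_gt0; rewrite !subr0.
  by apply: mulr_gt0; apply: divr_gt0 => //; [apply: divr_gt0|apply: mulr_gt0].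
have h0 := legendre_sqnorm_gt0 R k.
have e1 : lk / 2 / lead k ^+ 2 = h k / 2 by rewrite mulrAC lE.
have e2 : 3 / 2 * lk / lead k ^+ 2 = 3 / 2 * h k by rewrite -mulrA lE.
by rewrite /pencil_lim leqnn e1 e2; nra.
Qed.

Lemma K_ends : K (lk / 2) /\ K (3 / 2 * lk).
Proof. by rewrite /pencil_range /=; split; apply/andP; split; move: lk_gt0; lra. Qed.

Lemma det_pencil_ends : \forall T \near (0 : R)^'+,
  \det (pencil T (lk / 2)) * \det (pencil T (3 / 2 * lk)) < 0.
Proof.
set p := \prod_(i < n) pencil_lim (lk / 2) i.
set r := \prod_(i < n) pencil_lim (3 / 2 * lk) i.
have pr := pencil_ends; rewrite -/p -/r in pr.
have same (x y : R) : `|x - y| < `|y| -> 0 < x * y.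
  by case: (ger0P y) => y0; rewrite ltr_norml => /andP[? ?]; nra.
have p0 : 0 < `|p| by rewrite normr_gt0; apply: contraTneq pr => ->; rewrite mul0r ltxx.
have r0 : 0 < `|r| by rewrite normr_gt0; apply: contraTneq pr => ->; rewrite mulr0 ltxx.
have [K1 K2] := K_ends.
apply: filterS2 (bigO1_small p0 det_pencil1) (bigO1_small r0 det_pencil1).
move=> T /(_ _ K1)/same hp /(_ _ K2)/same hr; rewrite -/p -/r in hp hr.
move: (mulr_gt0 hp hr); rewrite mulrACA (nmulr_lgt0 _ pr).
done.
Qed.

(** A sign change of the determinant gives the root; there the product of the
    diagonal entries is O(T^2), and all of them but the k-th are bounded away from
    0, so that the k-th one is O(T^2). *)
Lemma pencil_root : exists C : R, \forall T \near (0 : R)^'+, exists mu,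
  [/\ K mu, `|mu - lk * (1 + ritz A b k * T)| <= C * T ^+ 2 &
      root (char_poly (G T)) (T ^+ (2 * k).+1 * mu)].
Proof.
have [C hC] := det_pencil2; have [D hD] := pencil_pivot.
set g := \prod_(i < n | i != k) pencil_gap i.
have g0 : 0 < g by apply: prodr_gt0 => i _; exact: pencil_gap_gt0.
have l0 : 0 < lead k ^+ 2 by rewrite exprn_gt0 ?(lead_gt0 hAb).
exists (lead k ^+ 2 * (C / g + D)); near=> T.
have T0 : 0 < T by near: T; exact: nbhs_right_gt.
have ends : \det (pencil T (lk / 2)) * \det (pencil T (3 / 2 * lk)) < 0.
  by near: T; exact: det_pencil_ends.
have dB : 0 < \det (frame_mx T) ^+ 2.
  by rewrite lt_neqAle sqr_ge0 eq_sym expf_neq0 // frame_mx_unit.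
have Tn p : 0 < T ^+ p by rewrite exprn_gt0.
have [z /andP[z1 z2] rz] : exists2 z,
    T ^+ (2 * k).+1 * (lk / 2) <= z <= T ^+ (2 * k).+1 * (3 / 2 * lk) &
    root (char_poly (G T)) z.
  apply: poly_sign_root; first by rewrite ler_pM2l //; move: lk_gt0; lra.
  rewrite -(pmulr_llt0 _ (mulr_gt0 dB dB)) mulrACA !char_poly_pencil //.
  by rewrite mulrACA pmulr_rlt0 // mulr_gt0.
pose mu := z / T ^+ (2 * k).+1.
have zE : z = T ^+ (2 * k).+1 * mu by rewrite mulrC divfK // gt_eqF.
have Kmu : K mu.
  by rewrite /pencil_range /= ler_pdivlMr // ler_pdivrMr // mulrC z1 mulrC z2.
exists mu; rewrite -zE; split=> //.
have det0 : \det (pencil T mu) = 0.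
  have := char_poly_pencil mu T0; rewrite -zE (rootP rz) mul0r => /esym/eqP.
  by rewrite mulf_eq0 gt_eqF //= => /eqP.
have diag : `|\prod_i pencil T mu i i| <= C * T ^+ 2.
  have : forall mu, K mu -> `|\det (pencil T mu) - \prod_i pencil T mu i i| <= C * T ^+ 2.
    by near: T.
  by move/(_ mu Kmu); rewrite det0 sub0r normrN.
have gap : g <= `|\prod_(i < n | i != k) pencil T mu i i|.
  rewrite normr_prod; apply: ler_prod => i ik.
  rewrite ltW ?pencil_gap_gt0 //=.
  have : forall i : 'I_n, i != k -> forall mu, K mu -> pencil_gap i <= `|pencil T mu i i|.
    by near: T; exact: pencil_diag_ge_all.
  exact.
have piv : `|pencil T mu k k| <= C / g * T ^+ 2.
  rewrite mulrAC ler_pdivlMr //; apply: le_trans diag.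
  by rewrite (bigD1 k) //= normrM ler_wpM2l.
have piv2 : `|pencil T mu k k - (mu / lead k ^+ 2 - h k * (1 + ritz A b k * T))|
    <= D * T ^+ 2.
  have : forall mu, K mu -> `|pencil T mu k k
      - (mu / lead k ^+ 2 - h k * (1 + ritz A b k * T))| <= D * T ^+ 2.
    by near: T.
  exact.
have lE : mu - lk * (1 + ritz A b k * T) = lead k ^+ 2 *
    (pencil T mu k k - (pencil T mu k k
      - (mu / lead k ^+ 2 - h k * (1 + ritz A b k * T)))).
  by rewrite ellE; field; rewrite gt_eqF ?(lead_gt0 hAb).
rewrite lE normrM (gtr0_norm l0) -mulrA ler_pM2l // mulrDl.
by rewrite (le_trans (ler_normB _ _)) // lerD.
Unshelve. all: by end_near. Qed.

(** An eigenvector becomes, in the coordinates of the frame, a kernel vector of a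
    matrix whose rows other than the k-th are diagonally dominant; hence its
    largest coordinate is the k-th one. *)
Lemma pencil_kernel_max : \forall T \near (0 : R)^'+, forall mu (w : 'cV[R]_n),
  K mu -> pencil T mu *m w = 0 -> forall i, `|w i 0| <= `|w k 0|.
Proof.
have off : \forall T \near (0 : R)^'+, forall i j : 'I_n, i != j ->
    forall mu, K mu -> `|pencil T mu i j| < pencil_gap i / n%:R.
  apply: filter_forall => i; apply: filter_forall => j.
  have n0 : 0 < n%:R :> R by rewrite ltr0n (leq_trans _ (ltn_ord i)).
  have [->|ij] := eqVneq i j; first by apply: nearW => T.
  have g0 : 0 < pencil_gap i / n%:R by rewrite divr_gt0 // pencil_gap_gt0.
  by apply: filterS (bigO1_small g0 (pencil_offdiag ij)) => T hT _.
apply: filterS2 off pencil_diag_ge_all => T off dg mu w Kmu Zw.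
(* If the largest coordinate had an index i0 <> k, row i0 would give 0. *)
have [i0 _ hi0] := @arg_maxP _ _ _ k xpredT (fun i => `|w i 0|) isT.
have max i : `|w i 0| <= `|w i0 0| by exact: (hi0 i isT).
have [<- //|ik] := eqVneq i0 k.
suff w0 : `|w i0 0| = 0.
  by move=> i; rewrite (le_trans (max i)) // w0.
apply/eqP; apply: contraT => w0;
have {}w0 : 0 < `|w i0 0| by rewrite lt_neqAle eq_sym w0 /=.
have n0 : 0 < n%:R :> R by rewrite ltr0n (leq_trans _ (ltn_ord k)).
have row : pencil T mu i0 i0 * w i0 0 =
    - \sum_(j < n | j != i0) pencil T mu i0 j * w j 0.
  have /matrixP/(_ i0 0) := Zw; rewrite mxE [RHS]mxE (bigD1 i0) //= => /eqP.
  by rewrite addr_eq0 => /eqP.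
have lt : `|pencil T mu i0 i0| * `|w i0 0| < pencil_gap i0 * `|w i0 0|.
  rewrite -normrM row normrN.
  apply: (@le_lt_trans _ _ (\sum_(j < n | j != i0) pencil_gap i0 / n%:R * `|w i0 0|)).
    rewrite (le_trans (ler_norm_sum _ _ _)) //; apply: ler_sum => j ji.
    by rewrite normrM ler_pM // ltW // off // eq_sym.
  rewrite sumr_const -[ltLHS]mulr_natr [ltLHS]mulrAC ltr_pM2r // [ltLHS]mulrAC
    ltr_pdivrMr //.
  rewrite ltr_pM2l ?pencil_gap_gt0 // ltr_nat.
  rewrite -[X in (_ < X)%N](card_ord n) -[X in (_ < X)%N](cardC (pred1 i0)) card1 add1n.
  by rewrite ltnS; apply: eq_leq; apply: eq_card.
by move: (dg i0 ik mu Kmu); rewrite leNgt -(ltr_pM2r w0) lt.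
Qed.

(** Write x as the combination of the frame vectors with coefficients w. Only the
    frame vectors with i >= k have a component along q_k, and for i > k it is
    smaller by a factor T than for i = k, while w_k is the largest coefficient. *)
Lemma eigenvector_not_orthogonal : \forall T \near (0 : R)^'+,
  forall mu (x : 'cV[R]_n), K mu -> x != 0 ->
  G T *m x = (T ^+ (2 * k).+1 * mu) *: x -> dotp x (q k) != 0.
Proof.
set S := \sum_(i < n) `|graded_coef A b i k|.
have S0 : 0 <= S by apply: sumr_ge0.
have lk0 := lead_gt0 hAb (ltn_ord k).
have e0 : 0 < (lead k)^-1 / (S + 1) by rewrite divr_gt0 ?invr_gt0 // ltr_wpDl.
near=> T => mu x Kmu x0 Gx.
have T0 : 0 < T by near: T; exact: nbhs_right_gt.
have T1 : T <= 1 by near: T; exact: nbhs_right_le.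
have TS : T * (S + 1) < (lead k)^-1.
  rewrite -ltr_pdivlMr ?ltr_wpDl //; near: T; exact: nbhs_right_lt.
pose B := frame_mx T; have uB : B^T \in unitmx.
  by rewrite unitmx_tr unitmxE unitfE frame_mx_unit.
pose w := invmx B^T *m x; have xE : x = B^T *m w by rewrite mulKVmx.
have Zw : pencil T mu *m w = 0.
  have : T *: (pencil T mu *m w) = 0.
    rewrite scalemxAl -frame_mxE // -[_ *m w]mulmxA -xE -mulmxA mulmxBl Gx.
    by rewrite mul_scalar_mx subrr mulmx0.
  by move/eqP; rewrite scaler_eq0 gt_eqF //= => /eqP.
have wk : forall i, `|w i 0| <= `|w k 0|.
  have hk : forall mu (w : 'cV[R]_n),
    K mu -> pencil T mu *m w = 0 -> forall i, `|w i 0| <= `|w k 0|.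
    by near: T; exact: pencil_kernel_max.
  exact: (hk mu w Kmu Zw).
have w0 : 0 < `|w k 0|.
  rewrite normr_gt0; apply: contraNneq x0 => wk0; rewrite xE.
  suff -> : w = 0 by rewrite mulmx0.
  apply/colP => i; rewrite [RHS]mxE; apply/eqP; rewrite -normr_le0.
  by rewrite (le_trans (wk i)) // wk0 normr0.
have xq : T ^+ k * dotp x (q k) = w k 0 * (lead k)^-1 +
    \sum_(i < n | i != k) w i 0 * (T ^+ (i - k) * graded_coef A b i k).
  have -> : x = \sum_(i < n) w i 0 *: frame T i.
    rewrite xE; apply/colP => l; rewrite mxE summxE; apply: eq_bigr => i _.
    by rewrite mxE [X in X * _]mxE [RHS]mxE mulrC.
  rewrite dotp_suml mulr_sumr (bigD1 k) //=; congr (_ + _).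
    rewrite dotpZl dotp_frame // subnn minnn graded_coef_diag mul1r.
    by rewrite mulrCA mulVKf // gt_eqF ?exprn_gt0.
  apply: eq_bigr => i ik; rewrite dotpZl dotp_frame //.
  have [ki|ik'] := leqP k i; last by rewrite graded_coef_small // !mulr0.
  by rewrite mulrCA mulVKf // gt_eqF ?exprn_gt0.
apply: contraTneq w0 => xq0; rewrite -leNgt.
move: xq; rewrite xq0 mulr0 => /esym/eqP; rewrite addr_eq0 => /eqP wE.
rewrite leNgt; apply/negP => w0.
have : `|w k 0| * (lead k)^-1 <= `|w k 0| * (T * S).
  rewrite -[X in _ * X <= _](gtr0_norm (x := (lead k)^-1)) ?invr_gt0 //.
  rewrite -normrM wE normrN (le_trans (ler_norm_sum _ _ _)) // mulrA mulr_sumr.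
  rewrite [leRHS](bigD1 k) //= ler_wpDl ?mulr_ge0 // ?(ltW T0) //.
  apply: ler_sum => i; rewrite -val_eqE /= => ik.
  rewrite normrM -[leRHS]mulrA ler_pM // normrM.
  have [ki|ik'] := leqP i k.
    by rewrite graded_coef_small ?normr0 ?mulr0 // ltn_neqAle ik.
  rewrite ler_wpM2r // normrX gtr0_norm // -[leRHS]expr1 ler_wiXn2l ?(ltW T0) //.
  by rewrite subn_gt0.
rewrite ler_pM2l // leNgt; apply/negP; rewrite negbK; apply: le_lt_trans TS.
by rewrite ler_pM2l // lerDl.
Unshelve. all: by end_near. Qed.

End Pencil.

(** * Spectrum of the Gramian *)

Lemma eigenvaluesP (R : realType) n (M : 'M[R]_n) (s : seq R) :
  size s = n -> sorted >%R s -> all (root (char_poly M)) s ->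
  char_poly M = \prod_(x <- s) ('X - x%:P) /\ eigenvalues M = s.
Proof.
move=> sz ss rs.
have us : uniq s.
  by apply: sorted_uniq ss; [exact: rev_trans lt_trans|move=> x; exact: ltxx].
have cM : char_poly M = \prod_(x <- s) ('X - x%:P).
  rewrite {1}(@all_roots_prod_XsubC _ (char_poly M) s) ?uniq_rootsE //.
    by rewrite (monicP (char_poly_monic M)) scale1r.
  by rewrite size_char_poly sz.
split=> //.
have ss' : sorted >=%R s by apply: sub_sorted ss => x y /ltW.
have [s1 s2] : [set s : seq R | sorted >=%R s /\
    char_poly M = \prod_(x <- s) ('X - x%:P)] (eigenvalues M).
  by apply: xgetPex; exists s.
apply: (sorted_eq (rev_trans le_trans) ge_anti) => //.
by apply: prod_XsubC_eq; rewrite -s2.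
Qed.

Lemma powR_half (R : realType) (T : R) m : 0 <= T ->
  T `^ (m%:R / 2) = Num.sqrt (T ^+ m).
Proof.
by move=> T0; rewrite powRrM powR_mulrn // powR12_sqrt // exprn_ge0.
Qed.

Lemma prod_odd_powers (R : comPzRingType) (T : R) n :
  \prod_(k < n) T ^+ (2 * k).+1 = T ^+ (n ^ 2).
Proof.
elim: n => [|n IH]; first by rewrite big_ord0.
by rewrite big_ord_recr /= IH -exprD; congr (_ ^+ _); rewrite !expnS expn0; lia.
Qed.

Section Spectrum.
Variables (R : realType) (n : nat) (A : 'M[R]_n) (b : 'cV[R]_n).
Hypothesis hAb : kalman A b.
Notation q := (krylov_basis A b).
Notation G := (gramian A b).
Notation l := (ell A b).

Lemma ell_gt0 k : (k < n)%N -> 0 < l k.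
Proof. by move=> kN; exact: (@lk_gt0 R n A b hAb (Ordinal kN)). Qed.

(** The n roots have sizes T^(2k+1), so they are distinct, in decreasing order, and
    exhaust the roots of the characteristic polynomial. *)
Lemma eigenvalues_expansion : exists C : 'I_n -> R, \forall T \near (0 : R)^'+,
  [/\ forall k : 'I_n, l k / 2 <= lambda A b T k / T ^+ (2 * k).+1,
      forall k : 'I_n, `|lambda A b T k / T ^+ (2 * k).+1
                         - l k * (1 + ritz A b k * T)| <= C k * T ^+ 2,
      \det (G T) = \prod_(k < n) lambda A b T k,
      forall i j : 'I_n, i != j -> lambda A b T i != lambda A b T j &
      forall k : 'I_n, root (char_poly (G T)) (lambda A b T k) /\
        forall x : 'cV[R]_n, x != 0 -> G T *m x = lambda A b T k *: x ->
        dotp x (q k) != 0].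
Proof.
have l0 (k : 'I_n) : 0 < l k by exact: ell_gt0.
have /choice[C hC] := fun k : 'I_n => pencil_root hAb k; exists C.
have gap : \forall T \near (0 : R)^'+, forall i j : 'I_n, (i < j)%N ->
    T * (3 * l j) < l i.
  apply: filter_forall => i; apply: filter_forall => j.
  have c0 : 0 < l i / (3 * l j) by apply: divr_gt0 => //; exact: mulr_gt0.
  apply: filterS (nbhs_right_lt c0) => T hT _.
  by rewrite -ltr_pdivlMr //; exact: mulr_gt0.
near=> T.
have /andP[T0 T1] : 0 < T <= 1 by near: T; exact: near_unit.
have /choice[mu hmu] : forall k : 'I_n, exists mu,
  [/\ pencil_range A b k mu, `|mu - l k * (1 + ritz A b k * T)| <= C k * T ^+ 2 &
      root (char_poly (G T)) (T ^+ (2 * k).+1 * mu)].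
  by near: T; exact: filter_forall.
have hgap : forall i j : 'I_n, (i < j)%N -> T * (3 * l j) < l i by near: T.
have horth : forall (k : 'I_n) mu (x : 'cV[R]_n), pencil_range A b k mu ->
  x != 0 -> G T *m x = (T ^+ (2 * k).+1 * mu) *: x -> dotp x (q k) != 0.
  by near: T; apply: filter_forall => k; exact: eigenvector_not_orthogonal.
pose ev (k : 'I_n) := T ^+ (2 * k).+1 * mu k.
have dec (i j : 'I_n) : (i < j)%N -> ev j < ev i.
  move=> ij; have [/andP[_ m2] _ _] := hmu j; have [/andP[m1 _] _ _] := hmu i.
  have := hgap i j ij; rewrite /ev => g.
  have -> : (2 * j).+1 = ((2 * i).+1 + (2 * (j - i)))%N by lia.
  rewrite exprD -mulrA ltr_pM2l ?exprn_gt0 //.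
  apply: (@le_lt_trans _ _ (T * (3 / 2 * l j))); last by lra.
  rewrite ler_pM ?exprn_ge0 ?(ltW T0) //.
    have [/andP[m3 _] _ _] := hmu j; rewrite (le_trans _ m3) //.
    by rewrite divr_ge0 // ltW.
  by rewrite -[leRHS]expr1 ler_wiXn2l ?(ltW T0) //; lia.
pose s := [seq ev k | k <- enum 'I_n].
have [||| cM eM] := @eigenvaluesP R n (G T) s.
- by rewrite size_map size_enum_ord.
- apply: (@homo_sorted _ _ ev (fun i j : 'I_n => (i < j)%N)) => [i j /dec //|].
  rewrite -(@sorted_map _ _ val ltn) val_enum_ord; exact: iota_ltn_sorted.
- by apply/allP => _ /mapP[k _ ->]; have [] := hmu k.
have lamE (k : 'I_n) : lambda A b T k = ev k.
  by rewrite /lambda eM (nth_map k) ?size_enum_ord // nth_ord_enum.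
have muE (k : 'I_n) : lambda A b T k / T ^+ (2 * k).+1 = mu k.
  by rewrite lamE /ev mulrC mulKf // gt_eqF ?exprn_gt0.
split.
- by move=> k; rewrite muE; have [/andP[]] := hmu k.
- by move=> k; rewrite muE; have [] := hmu k.
- have := congr1 (fun p => p.[0]) cM.
  rewrite char_poly_horner horner_prod raddf0 sub0r -scaleN1r detZ big_map.
  rewrite big_enum /=.
  have -> : \prod_(k < n) ('X - (ev k)%:P).[0] =
      (-1) ^+ n * \prod_(k < n) lambda A b T k.
    rewrite -[in (-1) ^+ n](card_ord n) -prodr_const -big_split /=.
    by apply: eq_bigr => k _; rewrite hornerXsubC lamE sub0r mulN1r.
  by apply: mulfI; rewrite expf_neq0 // oppr_eq0 oner_eq0.
- move=> i j; rewrite !lamE -val_eqE /=; case: ltngtP => // /dec h _.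
    by rewrite gt_eqF.
  by rewrite lt_eqF.
- move=> k; rewrite lamE; have [Kmu _ rk] := hmu k; split=> // x x0 Gx.
  exact: horth Kmu x0 Gx.
Unshelve. all: by end_near. Qed.

(** A suitable multiple of any eigenvector satisfies the conditions that define
    psi_k, as it is not orthogonal to q_k; so the default value 0 is not taken. *)
Lemma psiP : \forall T \near (0 : R)^'+, forall k : 'I_n,
  G T *m psi A b T k = lambda A b T k *: psi A b T k /\ enorm (psi A b T k) = 1.
Proof.
have [C hC] := eigenvalues_expansion; apply: filterS hC => T [_ _ _ _ h] k.
have [rk orth] := h k; set lam := lambda A b T k in rk orth *.
have [v vG v0] : exists2 v : 'rV_n, v *m G T = lam *: v & v != 0.
  by apply/eigenvalueP; rewrite eigenvalue_root_char.
pose x := v^T; have x0 : x != 0 by rewrite trmx_eq0.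
have Gx : G T *m x = lam *: x.
  by rewrite -[G T]trmx_gramian -trmx_mul vG linearZ.
have xq := orth x x0 Gx.
suff [u [Gu nu qu]] : exists u, [/\ G T *m u = lam *: u, enorm u = 1 &
    0 < dotp u (q k)].
  have [] : [set v : 'cV[R]_n | [/\ G T *m v = lam *: v, enorm v = 1 &
    0 < dotp v (q k)]] (psi A b T k) by apply: xgetPex; exists u.
  by [].
have e0 : 0 < enorm x by rewrite enorm_gt0.
wlog qx : x x0 Gx xq e0 / 0 < dotp x (q k).
  move=> hw; have := xq; rewrite neq_lt => /orP[qx|qx]; last exact: (hw x).
  apply: (hw (- x)); rewrite ?oppr_eq0 // -scaleN1r.
  - by rewrite -scalemxAr Gx !scalerA mulrC.
  - by rewrite dotpZl mulN1r oppr_eq0.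
  - by rewrite enorm_gt0 scaleN1r oppr_eq0.
  - by rewrite dotpZl mulN1r oppr_gt0.
exists ((enorm x)^-1 *: x); split.
- by rewrite -scalemxAr Gx !scalerA mulrC.
- by rewrite enormZ ?invr_ge0 ?ltW // mulVf // gt_eqF.
- by rewrite dotpZl mulr_gt0 // invr_gt0.
Qed.

Lemma psi_orthonormal : \forall T \near (0 : R)^'+, forall i j : 'I_n,
  dotp (psi A b T i) (psi A b T j) = (i == j)%:R.
Proof.
have [C hC] := eigenvalues_expansion; apply: filterS2 hC psiP.
move=> T [_ _ _ dist _] hpsi i j; have [Gi ni] := hpsi i; have [Gj _] := hpsi j.
have [<-|ij] := eqVneq i j; first by rewrite -enorm_sqr ni expr1n.
have : (lambda A b T i - lambda A b T j) * dotp (psi A b T i) (psi A b T j) = 0.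
  by rewrite mulrBl -dotpZl -Gi dotp_mull trmx_gramian Gj dotpZr subrr.
by move/eqP; rewrite mulf_eq0 subr_eq0 (negPf (dist i j ij)) => /eqP.
Qed.

Lemma lambda_gt0 : \forall T \near (0 : R)^'+, forall k : 'I_n, 0 < lambda A b T k.
Proof.
have [C hC] := eigenvalues_expansion; near=> T => k.
have /andP[T0 _] : 0 < T <= 1 by near: T; exact: near_unit.
have h : forall k : 'I_n, l k / 2 <= lambda A b T k / T ^+ (2 * k).+1.
  by near: T; apply: filterS hC => T [].
have p0 : 0 < T ^+ (2 * k).+1 by rewrite exprn_gt0.
rewrite -(pmulr_lgt0 _ (_ : 0 < (T ^+ (2 * k).+1)^-1)) ?invr_gt0 //.
by apply: lt_le_trans (h k); rewrite divr_gt0 ?ell_gt0.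
Unshelve. all: by end_near. Qed.

(** The weight of z_k^2 in the exponent of the density at y_T(z). *)
Definition ratio T k : R := l k * T ^+ (2 * k).+1 / lambda A b T k.

Lemma quadratic_form_scaled_point : \forall T \near (0 : R)^'+, forall z : 'cV[R]_n,
  dotp (invmx (G T) *m scaled_point A b T z) (scaled_point A b T z) =
  \sum_(k < n) ratio T k * z k 0 ^+ 2.
Proof.
have [C hC] := eigenvalues_expansion; near=> T => z.
have /andP[T0 _] : 0 < T <= 1 by near: T; exact: near_unit.
have lam0 : forall k : 'I_n, 0 < lambda A b T k by near: T; exact: lambda_gt0.
have hpsi : forall k : 'I_n, G T *m psi A b T k = lambda A b T k *: psi A b T k /\
    enorm (psi A b T k) = 1 by near: T; exact: psiP.
have ortho : forall i j : 'I_n, dotp (psi A b T i) (psi A b T j) = (i == j)%:R.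
  by near: T; exact: psi_orthonormal.
have detG : \det (G T) = \prod_(k < n) lambda A b T k.
  by near: T; apply: filterS hC => T [].
have uG : G T \in unitmx.
  by rewrite unitmxE unitfE detG; apply/prodf_neq0 => k _; rewrite gt_eqF.
pose c (k : 'I_n) := Num.sqrt (l k) * T `^ (k.+1%:R - 1 / 2) * z k 0.
have -> : scaled_point A b T z = \sum_(k < n) c k *: psi A b T k by [].
have cE k : c k ^+ 2 = l k * T ^+ (2 * k).+1 * z k 0 ^+ 2.
  rewrite /c 2!exprMn sqr_sqrtr ?ltW ?ell_gt0 //; congr (_ * _ * _).
  transitivity (T `^ ((k.+1%:R - 1 / 2) * 2%:R)).
    by rewrite powRrM powR_mulrn // powR_ge0.
  rewrite -(powR_mulrn _ (ltW T0)); congr (_ `^ _).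
  by rewrite -!natr1 natrM; field.
rewrite mulmx_sumr dotp_suml; apply: eq_bigr => k _.
have -> : invmx (G T) *m (c k *: psi A b T k) =
    (c k / lambda A b T k) *: psi A b T k.
  rewrite -[RHS](mulKmx uG); congr (_ *m _).
  by rewrite -scalemxAr (hpsi k).1 scalerA divfK ?gt_eqF.
rewrite dotpZl dotp_sumr (bigD1 k) //= big1 ?addr0 => [|j jk]; last first.
  by rewrite dotpZr ortho eq_sym (negPf jk) mulr0.
by rewrite dotpZr ortho eqxx mulr1 mulrAC -expr2 cE /ratio mulrAC.
Unshelve. all: by end_near. Qed.

Lemma normalisation : \forall T \near (0 : R)^'+,
  T `^ ((n ^ 2)%:R / 2) * Num.sqrt (\prod_(k < n) l k) *
  ((2 * pi) `^ (n%:R / 2) * Num.sqrt (\det (G T)))^-1 =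
  Num.sqrt (\prod_(k < n) ratio T k) / (2 * pi) `^ (n%:R / 2).
Proof.
have [C hC] := eigenvalues_expansion; near=> T.
have /andP[T0 _] : 0 < T <= 1 by near: T; exact: near_unit.
have lam0 : forall k : 'I_n, 0 < lambda A b T k by near: T; exact: lambda_gt0.
have detG : \det (G T) = \prod_(k < n) lambda A b T k.
  by near: T; apply: filterS hC => T [].
have l0 : 0 < \prod_(k < n) l k by apply: prodr_gt0 => k _; exact: ell_gt0.
have d0 : 0 < \prod_(k < n) lambda A b T k by apply: prodr_gt0.
have -> : \prod_(k < n) ratio T k =
    (\prod_(k < n) l k) * T ^+ (n ^ 2) / (\prod_(k < n) lambda A b T k).
  by rewrite /ratio -prod_odd_powers -prodfV -!big_split.
rewrite detG powR_half ?ltW // !sqrtrM ?mulr_ge0 ?exprn_ge0 ?ltW // sqrtrV ?ltW //.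
by rewrite invfM; ring.
Unshelve. all: by end_near. Qed.

Section RatioExpansion.
Variables (I : Type) (K : set I).

Lemma ratio_expansion (k : 'I_n) :
  @bigO R I K 2 (fun T _ => ratio T k - (1 - ritz A b k * T)).
Proof.
have [C hC] := eigenvalues_expansion.
set a := ritz A b k; pose m T := lambda A b T k / T ^+ (2 * k).+1.
have h2 : @bigO R I K 2 (fun T _ => m T - l k * (1 + a * T)).
  by exists (C k); apply: filterS hC => T [_ h _ _ _] x _; exact: h.
have h0 : @bigO R I K 0 (fun T _ => (m T)^-1).
  exists (2 / l k); apply: filterS hC => T [h _ _ _ _] x _.
  have l0 := ell_gt0 (ltn_ord k); have lm := h k; rewrite -/(m T) in lm.
  have m0 : 0 < m T by apply: lt_le_trans lm; rewrite divr_gt0.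
  by rewrite gtr0_norm ?invr_gt0 // mulr1 ler_pdivlMr // mulrC ler_pdivrMr //; lra.
have ha : @bigO R I K 0 (fun T _ => 1 - a * T).
  apply: bigOB; first exact: bigO_cst.
  have h1 := bigOM (bigO_cst K a) (bigO_exprn R K 1).
  by apply: (bigO_ext _ (bigO_le (leq0n _) h1)) => T x; rewrite expr1.
have hT : @bigO R I K 2 (fun T _ => l k * a ^+ 2 * T ^+ 2).
  exact: (bigOM (bigO_cst K _) (bigO_exprn R K 2)).
apply: (bigO_near _ (bigO0M h0 (bigOB hT (bigOM0 h2 ha)))).
apply: filterS2 lambda_gt0 (@near_unit R).
move=> T lam0 /andP[T0 _] x _; rewrite /ratio -/a /m.
have := lam0 k; move: (lambda A b T k) => lam lam1.
have p0 : 0 < T ^+ (2 * k).+1 by rewrite exprn_gt0.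
by field; rewrite !gt_eqF.
Qed.

End RatioExpansion.

End Spectrum.

(** * Expansion of the density *)

Section ExpansionCalculus.
Variables (R : realType) (I : Type) (K : set I).
Implicit Types f g : R -> I -> R.

Lemma bigO_dominated m f g :
  (\forall T \near (0 : R)^'+, forall x, K x -> `|g T x| <= `|f T x|) ->
  bigO K m f -> bigO K m g.
Proof.
move=> fg [C hC]; exists C; apply: filterS2 fg hC => T fg hC x Kx.
exact: le_trans (fg x Kx) (hC x Kx).
Qed.

Lemma bigO_linear (c : I -> R) M : (forall x, K x -> `|c x| <= M) ->
  bigO K 1 (fun T x => T * c x).
Proof.
move=> hc; have h := bigOM (bigO_exprn R K 1) (bigO_param hc).
by apply: (bigO_ext _ h) => T x; rewrite expr1.
Qed.

Lemma bigO_prod1 (J : Type) (r : seq J) (c : J -> R) :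
  bigO K 2 (fun T _ => \prod_(j <- r) (1 - c j * T) - (1 - T * \sum_(j <- r) c j)).
Proof.
elim: r => [|j r IH].
  by apply: (bigO_ext _ (bigO0 R K 2)) => T x; rewrite !big_nil mulr0 subr0 subrr.
have h1 : bigO K 0 (fun T _ => 1 - c j * T).
  apply: bigOB; first exact: bigO_cst.
  have h := bigOM (bigO_cst K (c j)) (bigO_exprn R K 1).
  by apply: (bigO_ext _ (bigO_le (leq0n _) h)) => T x; rewrite expr1.
have h2 : bigO K 2 (fun T _ => c j * (\sum_(i <- r) c i) * T ^+ 2).
  exact: (bigOM (bigO_cst K _) (bigO_exprn R K 2)).
by apply: (bigO_ext _ (bigOD (bigO0M h1 IH) h2)) => T x; rewrite !big_cons; ring.
Qed.

(** The error of the linear approximation of sqrt y at 1 is (sqrt y - 1)^2 / 2,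
    which is at most (y - 1)^2. *)
Lemma bigO_sqrt f g : bigO K 1 g -> bigO K 2 (fun T x => f T x - (1 + g T x)) ->
  bigO K 2 (fun T x => Num.sqrt (f T x) - (1 + g T x / 2)).
Proof.
move=> hg hf.
have hf1 : bigO K 1 (fun T x => f T x - 1).
  apply: (bigO_ext _ (bigOD (bigO_le (isT : 1 <= 2)%N hf) hg)) => T x; ring.
have h2 : bigO K 2 (fun T x => Num.sqrt (f T x) - (1 + (f T x - 1) / 2)).
  apply: bigO_dominated (bigOM hf1 hf1).
  apply: filterS (bigO1_small ltr01 hf1) => T small x Kx.
  have f0 : 0 <= f T x by have := small x Kx; rewrite ltr_norml => /andP[]; lra.
  have s0 := sqrtr_ge0 (f T x); have := sqr_sqrtr f0.
  move: (Num.sqrt (f T x)) s0 => s s0 <-.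
  have -> : s - (1 + (s ^+ 2 - 1) / 2) = - ((s - 1) ^+ 2 / 2) by field.
  have -> : (s ^+ 2 - 1) * (s ^+ 2 - 1) = (s - 1) ^+ 2 * (s + 1) ^+ 2 by ring.
  have n1 : 0 <= (s - 1) ^+ 2 / 2 by rewrite divr_ge0 ?sqr_ge0.
  have n2 : 0 <= (s - 1) ^+ 2 * (s + 1) ^+ 2 by rewrite mulr_ge0 ?sqr_ge0.
  rewrite normrN (ger0_norm n1) (ger0_norm n2) ler_wpM2l ?sqr_ge0 //; nra.
by apply: (bigO_ext _ (bigOD h2 (bigO0M (bigO_cst K 2^-1) hf))) => T x; field.
Qed.

(** From e^(-w) >= 1 - w one gets 0 <= e^w - 1 - w <= w^2 / (1 - w) <= 2 w^2 for
    w <= 1/2. *)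
Lemma bigO_expR f : bigO K 1 f -> bigO K 2 (fun T x => expR (f T x) - (1 + f T x)).
Proof.
move=> hf; apply: bigO_dominated (bigO0M (bigO_cst K 2) (bigOM hf hf)).
have half : 0 < 1 / 2 :> R by lra.
apply: filterS (bigO1_small half hf) => T small x Kx.
have := small x Kx; rewrite ltr_norml; move: (f T x) => w /andP[w1 w2].
have e1 := expR_ge1Dx w; have e2 := expR_ge1Dx (- w).
have e3 : expR w * expR (- w) = 1 by rewrite -expRD subrr expR0.
have e0 := expR_gt0 w.
rewrite ger0_norm ?subr_ge0 // ger0_norm; last by nra.
have : expR w * (1 + - w) <= 1.
  by have := ler_wpM2l (ltW e0) e2; rewrite e3.
by nra.
Qed.

End ExpansionCalculus.

Lemma compact_coords_bounded (R : realType) n (K : set 'cV[R]_n) : compact K ->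
  exists M : R, forall z, K z -> forall i, `|z i 0| <= M.
Proof.
move=> /compact_bounded [M [_ hM]]; exists (M + 1) => z Kz i.
apply: le_trans (hM (M + 1) _ z Kz); last by rewrite ltrDl.
rewrite [leRHS]/Num.Def.normr /= mx_normrE.
exact: (@le_bigmax _ _ _ _ (fun ij : 'I_n * 'I_1 => `|z ij.1 ij.2|) (i, 0)).
Qed.

Section DensityExpansion.
Variables (R : realType) (n : nat) (A : 'M[R]_n) (b : 'cV[R]_n).
Hypothesis hAb : kalman A b.
Variables (K : set 'cV[R]_n).
Hypothesis hK : compact K.
Notation a k := (ritz A b k).
Notation ratio := (ratio A b).

Let S (z : 'cV[R]_n) := \sum_(k < n) a k * z k 0 ^+ 2.

Lemma sqrt_ratio_expansion : @bigO R _ K 2 (fun T _ =>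
  Num.sqrt (\prod_(k < n) ratio T k) - (1 - T / 2 * \sum_(k < n) a k)).
Proof.
have h1 (k : 'I_n) : @bigO R _ K 0 (fun T _ => 1 - a k * T).
  apply: bigOB; first exact: bigO_cst.
  have h := bigOM (bigO_cst K (a k)) (bigO_exprn R K 1).
  by apply: (bigO_ext _ (bigO_le (leq0n _) h)) => T x; rewrite expr1.
have h2 (k : 'I_n) := ratio_expansion hAb K k.
have h0 (k : 'I_n) : @bigO R _ K 0 (fun T _ => ratio T k).
  apply: (bigO_ext _ (bigOD (bigO_le (leq0n 2) (h2 k)) (h1 k))) => T x.
  by rewrite subrK.
have h3 := bigO_prodB (index_enum 'I_n) h0 h1 h2.
have h4 := bigO_prod1 K (index_enum 'I_n) (fun k : 'I_n => a k).
have h5 : @bigO R _ K 1 (fun T (_ : 'cV[R]_n) => T * - \sum_(k < n) a k).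
  by apply: (@bigO_linear _ _ _ _ `|- \sum_(k < n) a k|) => z _.
have h6 : @bigO R _ K 2 (fun T (_ : 'cV[R]_n) =>
    \prod_(k < n) ratio T k - (1 + T * - \sum_(k < n) a k)).
  by apply: (bigO_ext _ (bigOD h3 h4)) => T x; ring.
by apply: (bigO_ext _ (bigO_sqrt h5 h6)) => T x; field.
Qed.

Lemma bigO_coord_sqr (k : 'I_n) : @bigO R _ K 0 (fun _ z => z k 0 ^+ 2).
Proof.
have [M hM] := compact_coords_bounded hK.
apply: (@bigO_param _ _ _ _ (M ^+ 2)) => z Kz.
rewrite normrX; apply: lerXn2r; rewrite ?nnegrE //; last exact: hM.
exact: le_trans (hM z Kz k).
Qed.

Lemma bigO_ritz_form : @bigO R _ K 0 (fun _ z => 2^-1 * S z).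
Proof.
apply: bigO0M; first exact: bigO_cst.
apply: bigO_sum => k _.
by apply: bigO0M; [exact: bigO_cst|exact: bigO_coord_sqr].
Qed.

Lemma exponent_expansion : @bigO R _ K 2 (fun T z =>
  expR (2^-1 * \sum_(k < n) (1 - ratio T k) * z k 0 ^+ 2) - (1 + T / 2 * S z)).
Proof.
have h1 : @bigO R _ K 2 (fun T z =>
    2^-1 * \sum_(k < n) (1 - ratio T k) * z k 0 ^+ 2 - T / 2 * S z).
  apply: (bigO_ext (f := fun (T : R) (z : 'cV[R]_n) => - 2^-1 * \sum_(k < n)
     (ratio T k - (1 - a k * T)) * z k 0 ^+ 2)).
    by move=> T z; rewrite /S !mulr_sumr -sumrB; apply: eq_bigr => k _; field.
  apply: bigO0M; first exact: bigO_cst.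
  apply: bigO_sum => k _.
  by apply: bigOM0; [exact: ratio_expansion|exact: bigO_coord_sqr].
have h2 : @bigO R _ K 1 (fun T z => T / 2 * S z).
  have h := bigOM0 (bigO_exprn R K 1) bigO_ritz_form.
  by apply: (bigO_ext _ h) => T z; rewrite expr1 mulrA.
have h3 := bigOD (bigO_le (isT : 1 <= 2)%N h1) h2.
have h4 : @bigO R _ K 1 (fun T z =>
    2^-1 * \sum_(k < n) (1 - ratio T k) * z k 0 ^+ 2).
  by apply: (bigO_ext _ h3) => T z; rewrite subrK.
by apply: (bigO_ext _ (bigOD (bigO_expR h4) h1)) => T z; ring.
Qed.

Lemma density_remainder : @bigO R _ K 2 (fun T z =>
  Num.sqrt (\prod_(k < n) ratio T k) *
  expR (2^-1 * \sum_(k < n) (1 - ratio T k) * z k 0 ^+ 2)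
  - (1 + T / 2 * \sum_(k < n) a k * (z k 0 ^+ 2 - 1))).
Proof.
have hT c : @bigO R _ K 0 (fun T _ => T * c).
  have h := bigOM (bigO_exprn R K 1) (bigO_cst K c).
  by apply: (bigO_ext _ (bigO_le (leq0n _) h)) => T z; rewrite expr1.
have hS : @bigO R _ K 0 (fun T z => 1 + T / 2 * S z).
  apply: bigOD; first exact: bigO_cst.
  have h := bigOM (bigO_exprn R K 1) bigO_ritz_form.
  by apply: (bigO_ext _ (bigO_le (leq0n _) h)) => T z; rewrite expr1 mulrA.
set sa := \sum_(k < n) a k.
have hD : @bigO R _ K 0 (fun T _ => Num.sqrt (\prod_(k < n) ratio T k)).
  have h := bigOB (bigO_cst K 1) (hT (2^-1 * sa)).
  apply: (bigO_ext _ (bigOD (bigO_le (leq0n 2) sqrt_ratio_expansion) h)) => T z.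
  by rewrite mulrA subrK.
have h1 := bigOM0 sqrt_ratio_expansion hS.
have h2 := bigO0M hD exponent_expansion.
have h3 := bigOM0 (bigOM0 (bigO_exprn R K 2) (bigO_cst K (- (2^-1 * sa)))) bigO_ritz_form.
apply: (bigO_ext _ (bigOD (bigOD h1 h2) h3)) => T z.
have -> : \sum_(k < n) a k * (z k 0 ^+ 2 - 1) = S z - sa.
  by rewrite /S /sa -sumrB; apply: eq_bigr => k _; rewrite mulrBr mulr1.
by rewrite -/sa; field.
Qed.

End DensityExpansion.

Unset Implicit Arguments.

Theorem corollary9 (R : realType) (n : nat) (A : 'M[R]_n) (b : 'cV[R]_n)
  (hAb : kalman A b) (K : set 'cV[R]_n) (hK : compact K) :
  exists C : R, \forall T \near (0 : R)^'+, forall z : 'cV[R]_n, K z ->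
    exists2 r : R, `|r| <= C * T ^+ 2 &
      T `^ ((n ^ 2)%:R / 2) * Num.sqrt (\prod_(k < n) ell A b k)
        * ou_density A b T (scaled_point A b T z)
      = expR (- (enorm z ^+ 2 / 2)) / (2 * pi) `^ (n%:R / 2)
        * (1 + T / 2 * (\sum_(k < n) ritz A b k * (z k 0 ^+ 2 - 1)) + r).
Proof.
have [C hC] := density_remainder hAb hK; exists C.
apply: filterS3 hC (normalisation hAb) (quadratic_form_scaled_point hAb).
move=> T hC norm quad z Kz; eexists; first exact: hC Kz.
rewrite [X in _ = _ * X]addrC subrK /ou_density mulrA norm quad.
have <- : expR (- (enorm z ^+ 2 / 2)) *
    expR (2^-1 * \sum_(k < n) (1 - ratio A b T k) * z k 0 ^+ 2) =
    expR (- (1 / 2) * \sum_(k < n) ratio A b T k * z k 0 ^+ 2).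
  rewrite -expRD enorm_sqr /dotp mulr_suml !mulr_sumr -sumrN -big_split.
  by congr expR; apply: eq_bigr => k _ /=; field.
ring.
Qed.
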